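(* Let $\delta > 0$, $K \ge 0$ and $T > 0$. There exist positive constants $c_0 = c_0(\delta, K, T)$ and $N_0 = N_0(\delta, K, T)$, depending only on $\delta,K,T$, such that the following statements hold for all $\mathbf{v} \in S_\delta \cap \mathbb{Z}_{\ge N_0}^2$, $p \in [1, T \|\mathbf{v}\|]$, $w > 0$ and $z < 1$. (a) If $w \le \zeta_{\mathbf{v}}+K\min \{p^{1/3}\|\mathbf{v}\|^{-1/3}, 1\}$ then $$\mathbf{E}[|G^{w, \mathrm{hor}}_{\mathbf{v}}-\gamma_{\mathbf{v}}|^p] \ge c_0^p p^{2p/3} \|\mathbf{v}\|^{p/3}.$$ (b) If $z \ge \zeta_{\mathbf{v}}-K\min \{p^{1/3}\|\mathbf{v}\|^{-1/3}, 1\}$ then $$\mathbf{E}[|G^{z, \mathrm{ver}}_{\mathbf{v}}-\gamma_{\mathbf{v}}|^p] \ge c_0^p p^{2p/3} \|\mathbf{v}\|^{p/3}.$$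
   Context: $\mathrm{Exp}(\lambda)$ is the exponential distribution with rate $\lambda$. For $w>0$ and $z<1$, let $\{\omega^{w,z}_{\mathbf{v}}:\mathbf{v}\in\mathbb{Z}_{\ge0}^2\}$ be independent weights with $\omega^{w,z}_{\mathbf{v}}\sim\mathrm{Exp}(1)$ for $\mathbf{v}\in\mathbb{Z}_{>0}^2$, $\omega^{w,z}_{(i,0)}\sim\mathrm{Exp}(w)$ for $i\in\mathbb{Z}_{>0}$, $\omega^{w,z}_{(0,j)}\sim\mathrm{Exp}(1-z)$ for $j\in\mathbb{Z}_{>0}$, and $\omega^{w,z}_{(0,0)}=0$. $\Pi_{\mathbf{u},\mathbf{v}}$ is the set of up-right lattice paths from $\mathbf{u}$ to $\mathbf{v}$ with steps $(1,0)$ and $(0,1)$, viewed as vertex sets including both endpoints. Put $G^{w,\mathrm{hor}}_{\mathbf{v}}=\max_{\pi\in\Pi_{(1,0),\mathbf{v}}}\sum_{\mathbf{p}\in\pi}\omega^{w,z}_{\mathbf{p}}$ (which does not depend on $z$) and $G^{z,\mathrm{ver}}_{\mathbf{v}}=\max_{\pi\in\Pi_{(0,1),\mathbf{v}}}\sum_{\mathbf{p}\in\pi}\omega^{w,z}_{\mathbf{p}}$ (which does not depend on $w$), for $\mathbf{v}\in\mathbb{Z}_{>0}^2$. For $\mathbf{x}=(x,y)\in\mathbb{R}_{>0}^2$, $\gamma_{\mathbf{x}}=(\sqrt{x}+\sqrt{y})^2$ and $\zeta_{\mathbf{x}}=\frac{\sqrt{x}}{\sqrt{x}+\sqrt{y}}$.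 $\|\cdot\|$ is the $L^1$ norm. $S_\delta = \{(x,y)\in\mathbb{R}_{>0}^2: x\ge \delta y,\ y\ge\delta x\}$, and $\mathbb{Z}_{\ge N}=\{n\in\mathbb{Z}: n\ge N\}$. *)

(* Defs.v *)
From HB Require Import structures.
From mathcomp Require Import all_boot all_order all_algebra.
From mathcomp Require Import all_classical all_reals all_analysis.

Set Implicit Arguments.
Unset Strict Implicit.
Unset Printing Implicit Defensive.
Import Order.TTheory GRing.Theory Num.Theory.
Import numFieldNormedType.Exports.

Local Open Scope classical_set_scope.
Local Open Scope ring_scope.

Definition up_right_step : rel (nat * nat) := fun p q =>
  (q == (p.1.+1, p.2)) || (q == (p.1, p.2.+1)).

(* A path is the sequence of its vertices, both endpoints included; up-right
   paths visit no vertex twice, so summing over the sequence is the same as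
   summing over the vertex set. *)
Definition up_right_paths (u v : nat * nat) : set (seq (nat * nat)) :=
  [set s | exists t, [/\ s = u :: t, path up_right_step u t & last u t = v]].

(* The supremum is a maximum whenever there is a path from u to v:
   see last_passage_max below. *)
Definition last_passage (R : realType) (f : nat * nat -> R) (u v : nat * nat)
    : R :=
  sup [set \sum_(q <- s) f q | s in up_right_paths u v].

Fixpoint path_enum (n : nat) (u : nat * nat) : seq (seq (nat * nat)) :=
  if n is m.+1 then
    [seq u :: s | s <- path_enum m (u.1.+1, u.2) ++ path_enum m (u.1, u.2.+1)]
  else [:: [:: u]].

Lemma path_enumP (t : seq (nat * nat)) (u : nat * nat) :
  path up_right_step u t -> u :: t \in path_enum (size t) u.
Proof.
elim: t u => [|a t IH] u /=; first by rewrite inE.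
case/andP=> /orP[] /eqP ea pt; apply: map_f; rewrite mem_cat -ea IH //.
by rewrite orbT.
Qed.

Lemma size_up_right (t : seq (nat * nat)) (u : nat * nat) :
  path up_right_step u t ->
  ((last u t).1 + (last u t).2 = u.1 + u.2 + size t)%N.
Proof.
elim: t u => [|a t IH] u /=; first by rewrite addn0.
by case/andP=> /orP[] /eqP ea /IH ->; rewrite ea /= ?addnS !addSn.
Qed.

Lemma last_passage_max (R : realType) (f : nat * nat -> R) (u v : nat * nat) :
  up_right_paths u v !=set0 ->
  (exists2 s, up_right_paths u v s & last_passage f u v = \sum_(q <- s) f q) /\
  (forall s, up_right_paths u v s -> \sum_(q <- s) f q <= last_passage f u v).
Proof.
move=> [s0 Ps0].
pose n := ((v.1 + v.2) - (u.1 + u.2))%N.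
pose l := [seq s <- path_enum n u | `[< up_right_paths u v s >]].
have lP s : s \in l <-> up_right_paths u v s.
  split=> [|Ps]; first by rewrite mem_filter => /andP[/asboolP].
  rewrite mem_filter; apply/andP; split; first exact/asboolP.
  case: Ps => t [-> pt lt]; rewrite /n -lt size_up_right// addKn.
  exact: path_enumP.
have [s Ps smax] : exists2 s, s \in l &
    forall s', s' \in l -> \sum_(q <- s') f q <= \sum_(q <- s) f q.
  have : l != [::] by apply/eqP => l0; move/lP: Ps0; rewrite l0.
  elim: (l) => // a [|b r] IH _.
    by exists a; rewrite ?mem_head// => s'; rewrite inE => /eqP->.
  have [s sl smax] := IH isT.
  have [le|/ltW ge] := leP (\sum_(q <- a) f q) (\sum_(q <- s) f q).
    exists s; first by rewrite inE sl orbT.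
    by move=> s'; rewrite inE => /orP[/eqP-> //|/smax].
  exists a; first exact: mem_head.
  by move=> s'; rewrite inE => /orP[/eqP-> //|/smax/le_trans]; exact.
have ub : ubound [set \sum_(q <- s') f q | s' in up_right_paths u v]
    (\sum_(q <- s) f q).
  by move=> _ [s' /lP ls' <-]; exact: smax.
split=> [|s' Ps'].
  exists s; first exact/lP.
  apply/eqP; rewrite eq_le; apply/andP; split.
    by apply: ge_sup => //; exists (\sum_(q <- s) f q), s => //; exact/lP.
  by apply: ub_le_sup; [exists (\sum_(q <- s) f q)|exists s => //; exact/lP].
by apply: ub_le_sup; [exists (\sum_(q <- s) f q)|exists s'].
Qed.

Section weights.
Context d (Omega : measurableType d) (R : realType) (P : probability Omega R).

(* Equality is required on measurable sets only: a measure of the library is a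
   function on all sets, with unspecified values outside the sigma-algebra. *)
Definition has_law (X : {RV P >-> R}) (mu : set R -> \bar R) : Prop :=
  forall B : set R, measurable B -> distribution P X B = mu B.

Definition mutually_independent (I : eqType) (X : I -> {RV P >-> R}) : Prop :=
  forall (s : seq I) (B : I -> set R), uniq s ->
    (forall i, measurable (B i)) ->
    P (\big[setI/setT]_(i <- s) (X i @^-1` B i)) =
    (\prod_(i <- s) P (X i @^-1` B i))%E.

Record boundary_weights (w z : R) (omega : nat * nat -> {RV P >-> R}) : Prop :=
  BoundaryWeights {
    weight_bulk : forall i j, has_law (omega (i.+1, j.+1)) (exponential_prob 1);
    weight_hor : forall i, has_law (omega (i.+1, 0%N)) (exponential_prob w);
    weight_ver : forall j,
      has_law (omega (0%N, j.+1)) (exponential_prob (1 - z));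
    weight_origin : forall t, omega (0%N, 0%N) t = 0;
    weight_indep : mutually_independent omega }.

Definition Ghor (omega : nat * nat -> {RV P >-> R}) (v : nat * nat) : Omega -> R :=
  fun t => last_passage (fun q => omega q t) (1%N, 0%N) v.

Definition Gver (omega : nat * nat -> {RV P >-> R}) (v : nat * nat) : Omega -> R :=
  fun t => last_passage (fun q => omega q t) (0%N, 1%N) v.

End weights.

Section shape.
Context {R : realType}.
Implicit Types x : R * R.

Definition gamma x : R := (Num.sqrt x.1 + Num.sqrt x.2) ^+ 2.

Definition zeta x : R := Num.sqrt x.1 / (Num.sqrt x.1 + Num.sqrt x.2).

(* The library's norm on R * R is the sup norm. *)
Definition norm1 x : R := `|x.1| + `|x.2|.

Definition cone (delta : R) : set (R * R) :=
  [set x | [/\ 0 < x.1, 0 < x.2, delta * x.2 <= x.1 & delta * x.1 <= x.2]].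

Definition vec (v : nat * nat) : R * R := (v.1%:R, v.2%:R).

End shape.

(* Main.v *)
From HB Require Import structures.
Require Import Defs.
From mathcomp Require Import all_boot all_order all_algebra.
From mathcomp Require Import all_classical all_reals all_analysis.
From mathcomp Require Import measurable_realfun ring lra.
Import Order.TTheory GRing.Theory Num.Theory.
Import numFieldNormedType.Exports.
Set Implicit Arguments.
Unset Strict Implicit.
Unset Printing Implicit Defensive.
Local Open Scope classical_set_scope.
Local Open Scope ring_scope.

(** Only part (a) needs an argument: reflecting the lattice in the diagonal turns
    (b) into (a), with zeta replaced by 1 - zeta and (w, z) by (1 - z, 1 - w).

    Write N for the L^1 norm of v, G for gamma, r for zeta, hor for the
    last-passage time of (a), and s = (p / N)^(1/3). The right-hand side of (a) is
    (c0 s^2 N)^p, so it suffices to bound P(hor >= G + s^2 N) from below by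
    exp(- C p) with C depending on delta, K, T only ([moment_ge_of_tail]).

    When s is bounded below, p is comparable to N and the level G + s^2 N is at most
    a multiple of N. It is exceeded as soon as all bulk weights along one fixed path
    are larger than a constant, which has probability exp(- O(N)) ([far_tail_hor]).

    When s is small, the tail comes from an exact formula. Let L be the last-passage
    time of the model with both boundaries, of parameters w and z, so that L is the
    maximum of hor and of its vertical counterpart ver. Then ([lpp_mgf])
      E exp((w - z) L) = (w / z)^m ((1 - z) / (1 - w))^n    for v = (m, n).
    Changing the measure by the factor exp((w - z) x) at each of the m weights x of
    the bottom boundary turns these weights into exponential ones of rate z. This
    makes the model stationary, and the Burke property then says that the increments
    of L along the right side are independent exponential variables of rate 1 - z.
    The change of measure has absorbed the value of L at the lower right corner, so
    that only these increments remain to be integrated. Expanding at the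
    characteristic parameter r, where the quadratic terms cancel, gives for
    w = r + a k and z = r - b k
      log E exp((a + b) k L) = (a + b) k G + (a^3 + b^3) y / 3,  up to a small error,
    with y = G k^3 / (r (1 - r)) ([lpp_mgf_value_bounds]).

    Take k = (K + 1) s and w = r + k. The point is that the exponent 4 k splits in
    two ways: as (1 + 3) k, with cubic coefficient 1 + 27 = 28, and as (2 + 2) k,
    with cubic coefficient 8 + 8 = 16. In the first splitting L is the maximum of
    hor and of a ver with parameter r - 3 k. This ver is below the one with
    parameter r - 2 k, hence below the L of the second splitting, so it
    accounts for at most half of the larger first value, and the other half is left
    for hor ([integral_expR_hor_ge]). The splitting
    (1 + 7) k of 8 k bounds the second moment of exp(4 k hor), and the Paley-Zygmund
    inequality gives P(hor >= G + G k^2 / (4 r (1 - r))) >= exp(- 130 y). For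
    smaller w the weights, hence hor, only get larger ([right_tail_hor]). The
    orders are right: G k^2 is comparable to s^2 N, and y to s^3 N = p, because r
    stays away from 0 and 1 on the cone. *)

(** * Densities and affine changes of variable *)

Definition density_measure d (T : measurableType d) (R : realType)
    (mu : {measure set T -> \bar R}) (f : T -> R)
    (mf : measurable_fun setT f) (f0 : forall x, 0 <= f x) (A : set T) : \bar R :=
  (\int[mu]_(x in A) (f x)%:E)%E.

Section density_measure.
Local Open Scope ereal_scope.
Context d (T : measurableType d) (R : realType).
Variables (mu : {measure set T -> \bar R}) (f : T -> R).
Hypotheses (mf : measurable_fun setT f) (f0 : forall x, (0 <= f x)%R).
Local Notation nu := (density_measure mu mf f0).

Let nu0 : nu set0 = 0.
Proof. by rewrite /density_measure integral_set0. Qed.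

Let nu_ge0 A : 0 <= nu A.
Proof. by apply: integral_ge0 => x _; rewrite lee_fin. Qed.

Let nu_sigma_additive : semi_sigma_additive nu.
Proof.
move=> /= F mF tF mUF; rewrite /density_measure; apply: cvg_toP.
  apply: ereal_nondecreasing_is_cvgn => m n mn.
  apply: lee_sum_nneg_natr => // k _ _; apply: integral_ge0 => /= x Fkx.
  by rewrite lee_fin.
rewrite ge0_integral_bigcup//=.
- by apply/measurable_EFinP; exact: measurable_funTS.
- by move=> x _; rewrite lee_fin.
Qed.

HB.instance Definition _ := isMeasure.Build _ _ _ nu nu0 nu_ge0 nu_sigma_additive.

Import HBNNSimple.

(** Both sides are linear and continuous along increasing sequences in g, which
    reduces the identity to indicator functions, where it is the definition. *)
Lemma ge0_integral_density (g : T -> \bar R) :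
  measurable_fun setT g -> (forall x, 0 <= g x) ->
  \int[nu]_x g x = \int[mu]_x (g x * (f x)%:E).
Proof.
move=> mg g0; pose g_ := nnsfun_approx measurableT mg.
have cvg_g x : (g_ n x)%:E @[n --> \oo] --> g x by exact: cvg_nnsfun_approx.
have mfE : measurable_fun setT (EFin \o f) by exact/measurable_EFinP.
transitivity (limn (fun n => \int[nu]_x (g_ n x)%:E)).
  rewrite -monotone_convergence//.
  - by apply: eq_integral => y _; apply/esym/cvg_lim => //; exact: cvg_g.
  - by move=> n; exact/measurable_EFinP/measurable_funP.
  - by move=> n y _; rewrite lee_fin.
  - by move=> y _ m n mn; rewrite lee_fin; exact/lefP/nd_nnsfun_approx.
have -> : \int[mu]_x (g x * (f x)%:E) =
    limn (fun n => \int[mu]_x ((g_ n x)%:E * (f x)%:E)).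
  rewrite -monotone_convergence//.
  - by apply: eq_integral => y _; apply/esym/cvg_lim => //;
      apply: cvgeZr => //; exact: cvg_g.
  - by move=> n; apply: emeasurable_funM => //; exact/measurable_EFinP.
  - by move=> n y _; rewrite mule_ge0 ?lee_fin.
  - move=> y _ m n mn; rewrite lee_wpmul2r ?lee_fin//.
    exact/lefP/nd_nnsfun_approx.
congr (limn _); apply/funext => n.
have ind_ge0 r x : 0 <= (r * \1_(g_ n @^-1` [set r]) x)%:E.
  by rewrite EFinM; exact: nnfun_muleindic_ge0.
have mind r : measurable_fun setT (fun x => (r * \1_(g_ n @^-1` [set r]) x)%:E).
  by apply/measurable_EFinP; exact: measurable_funM.
transitivity (\sum_(r \in range (g_ n))
    \int[nu]_x (r * \1_(g_ n @^-1` [set r]) x)%:E).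
  under eq_integral do rewrite fimfunE -fsumEFin//.
  by rewrite ge0_integral_fsum//.
transitivity (\sum_(r \in range (g_ n))
    \int[mu]_x ((r * \1_(g_ n @^-1` [set r]) x)%:E * (f x)%:E)); last first.
  rewrite -ge0_integral_fsum//.
  - apply: eq_integral => x _; rewrite -ge0_mule_fsuml; last first.
      by move=> y; exact: ind_ge0.
    by rewrite fsumEFin// -fimfunE.
  - by move=> r; exact: emeasurable_funM.
  - by move=> r x _; apply: mule_ge0; rewrite ?lee_fin//; exact: ind_ge0.
apply: eq_fsbigr => r; rewrite inE => -[t _ <-].
set S := g_ n @^-1` _.
have mS : measurable S by exact: measurable_sfunP.
under [LHS]eq_integral do rewrite EFinM.
rewrite ge0_integralZl_EFin//; last exact/measurable_EFinP.
rewrite integral_indic// setIT.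
under [RHS]eq_integral do rewrite EFinM -muleA.
rewrite ge0_integralZl_EFin//; last 2 first.
- by move=> x _; rewrite mule_ge0 ?lee_fin.
- by apply: emeasurable_funM => //; exact/measurable_EFinP.
congr (_ * _); rewrite /= /density_measure integral_mkcond.
apply: eq_integral => x _; rewrite /= patchE indicE.
by case: ifP; rewrite ?mul1e ?mul0e.
Qed.

End density_measure.

Section lebesgue_affine.
Local Open Scope ereal_scope.
Context {R : realType}.
Implicit Types (f : R -> \bar R) (c : R).
Local Notation mu := (@lebesgue_measure R).

Lemma ge0_integral_shift f c :
  measurable_fun setT f -> (forall x, 0 <= f x) ->
  \int[mu]_x f (x + c)%R = \int[mu]_x f x.
Proof.
move=> mf f0; pose phi : measurableTypeR R -> measurableTypeR R := (fun x => x + c)%R.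
have mphi : measurable_fun setT phi by exact: measurable_funD.
transitivity (\int[pushforward mu phi]_x f x).
  by rewrite ge0_integral_pushforward.
apply: eq_measure_integral => A mA _; apply/esym.
apply: lebesgue_measure_unique => //= _ [[a b]] _ <-.
rewrite /pushforward /= (_ : phi @^-1` _ = `](a - c)%R, (b - c)%R]%classic); last first.
  by apply/seteqP; split => x; rewrite /phi /= !in_itv/= ltrBlDr lerBrDr.
rewrite !lebesgue_measure_itv/= !lte_fin ltrD2r.
by case: ifP => // _; rewrite -!EFinD; congr EFin; ring.
Qed.

Lemma ge0_integral_scale f c : (0 < c)%R ->
  measurable_fun setT f -> (forall x, 0 <= f x) ->
  c%:E * \int[mu]_x f (c * x)%R = \int[mu]_x f x.
Proof.
move=> c0 mf f0; pose phi : measurableTypeR R -> measurableTypeR R := (fun x => c * x)%R.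
have mphi : measurable_fun setT phi by exact: measurable_funM.
transitivity (\int[pushforward (mscale (NngNum (ltW c0)) mu) phi]_x f x).
  rewrite ge0_integral_pushforward//= preimage_setT ge0_integral_mscale//.
  exact: (measurableT_comp mf).
apply: eq_measure_integral => A mA _; apply/esym.
apply: lebesgue_measure_unique => //= _ [[a b]] _ <-.
rewrite /mscale /pushforward /=.
rewrite (_ : phi @^-1` _ = `](a / c)%R, (b / c)%R]%classic); last first.
  by apply/seteqP; split => x; rewrite /phi /= !in_itv/= ltr_pdivrMr// ler_pdivlMr// mulrC.
rewrite !lebesgue_measure_itv/= !lte_fin ltr_pM2r ?invr_gt0//.
case: ifPn => _; last by rewrite mule0.
by rewrite -!EFinD -EFinM -mulrBl mulrC divfK ?gt_eqF.
Qed.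

End lebesgue_affine.

(** * Exponential laws *)

Section exponential_law.
Local Open Scope ereal_scope.
Context {R : realType}.
Local Notation mu := (@lebesgue_measure R).
Implicit Types (r : R).

Definition exponential_measure r (r0 : (0 < r)%R) : set (measurableTypeR R) -> \bar R :=
  density_measure mu (measurable_exponential_pdf r)
    (exponential_pdf_ge0 (ltW r0)).

HB.instance Definition _ r (r0 : (0 < r)%R) :=
  Measure.on (exponential_measure r0).

Let exponential_measureT r (r0 : (0 < r)%R) : exponential_measure r0 setT = 1.
Proof. exact: integral_exponential_pdf. Qed.

HB.instance Definition _ r (r0 : (0 < r)%R) :=
  Measure_isProbability.Build _ _ R (exponential_measure r0)
    (exponential_measureT r0).

(** Being total in the rate allows families of laws indexed by the whole quadrant.
    The degenerate value is the Dirac mass at 0, so that rate 0 describes the weight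
    at the origin. *)
Definition exponential_law r : probability (measurableTypeR R) R :=
  if pselect (0 < r)%R is left r0 then exponential_measure r0
  else \d_(0%R : measurableTypeR R).

Lemma exponential_lawE r A : (0 < r)%R ->
  exponential_law r A = exponential_prob r A.
Proof. by rewrite /exponential_law; case: pselect. Qed.

Lemma ge0_integral_exponential_law r (g : R -> \bar R) : (0 < r)%R ->
  measurable_fun setT g -> (forall x, 0 <= g x) ->
  \int[exponential_law r]_x g x = \int[mu]_x (g x * (exponential_pdf r x)%:E).
Proof.
move=> r0 mg g0; rewrite /exponential_law; case: pselect => // r0'.
exact: ge0_integral_density.
Qed.

Lemma exponential_pdf_tilt r s x : (s < r)%R ->
  (expR (s * x) * exponential_pdf r x = r / (r - s) * exponential_pdf (r - s) x)%R.
Proof.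
move=> sr; have [x0|x0] := ltP x 0%R.
  by rewrite !lt0_exponential_pdf// !mulr0.
rewrite !exponential_pdfE// [in RHS]mulrA divfK ?gt_eqF ?subr_gt0//.
by rewrite mulrCA -expRD; congr (_ * expR _)%R; ring.
Qed.

Lemma exponential_pdf_scale r c x : (0 < c)%R ->
  (c * exponential_pdf (r / c) (c * x) = exponential_pdf r x)%R.
Proof.
move=> c0; have [x0|x0] := ltP x 0%R.
  by rewrite !lt0_exponential_pdf ?mulr0// pmulr_rlt0.
rewrite !exponential_pdfE ?mulr_ge0 ?(ltW c0)// mulrA [(c * _)%R]mulrC divfK ?gt_eqF//.
by congr (_ * expR _)%R; rewrite !mulNr mulrA divfK ?gt_eqF.
Qed.

Lemma exponential_lawE_indic r (A : set R) : (0 < r)%R -> measurable A ->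
  exponential_law r A = \int[mu]_x (\1_A x * exponential_pdf r x)%:E.
Proof.
move=> r0 mA; rewrite -[A in LHS]setIT -integral_indic//.
rewrite ge0_integral_exponential_law//.
exact/measurable_EFinP.
Qed.

Lemma exponential_law_scale r c (A : set R) : (0 < r)%R -> (0 < c)%R ->
  measurable A ->
  exponential_law r ((fun x => c * x)%R @^-1` A) = exponential_law (r / c) A.
Proof.
move=> r0 c0 mA; rewrite !exponential_lawE_indic ?divr_gt0//; last first.
  by rewrite -[X in measurable X]setTI; exact: measurable_funM.
have mind : measurable_fun setT
    (fun x => (\1_A x * exponential_pdf (r / c) x)%:E : \bar R).
  apply/measurable_EFinP; apply: measurable_funM => //.
  exact: measurable_exponential_pdf.
have ind0 (x : R) : 0 <= (\1_A x * exponential_pdf (r / c) x)%:E.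
  by rewrite lee_fin mulr_ge0// exponential_pdf_ge0// divr_ge0 ?ltW.
rewrite -[RHS](ge0_integral_scale c0)//= -ge0_integralZl_EFin ?(ltW c0)//.
- apply: eq_integral => x _; rewrite -EFinM mulrCA exponential_pdf_scale//.
- exact: (measurableT_comp mind).
Qed.

End exponential_law.

(** * Products of two laws *)

Section product_probability.
Local Open Scope ereal_scope.
Context d1 d2 (T1 : measurableType d1) (T2 : measurableType d2) (R : realType).
Variables (P1 : probability T1 R) (P2 : probability T2 R).

Definition product_probability : set (T1 * T2) -> \bar R := P1 \x P2.

HB.instance Definition _ := Measure.on product_probability.

Lemma product_probabilityX A B : measurable A -> measurable B ->
  product_probability (A `*` B) = P1 A * P2 B.
Proof. exact: product_measure1E. Qed.

Let product_probabilityT : product_probability setT = 1.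
Proof.
rewrite -setXTT product_probabilityX//.
transitivity (1 * 1 : \bar R); last by rewrite mule1.
by congr (_ * _); exact: probability_setT.
Qed.

HB.instance Definition _ := Measure_isProbability.Build _ _ _
  product_probability product_probabilityT.

(** The constant c is there for laws restricted to an event without being
    normalized, as in [independent_with_laws_indep3]. *)
Lemma product_probability_unique (m : {measure set (T1 * T2) -> \bar R}) (c : R) :
  (0 <= c)%R ->
  (forall A B, measurable A -> measurable B ->
    m (A `*` B) = c%:E * (P1 A * P2 B)) ->
  forall X, measurable X -> m X = c%:E * product_probability X.
Proof.
move=> c0 mE X mX.
have := @product_measure_unique _ _ T1 T2 R
  (mscale (NngNum c0) P1) P2 m _ X mX => <-; last first.
  by move=> A B mA mB; rewrite mE// muleA.
rewrite /product_probability /product_measure1 ge0_integral_mscale//.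
exact: measurable_fun_xsection.
Qed.

Section integral.
Variable f : T1 * T2 -> \bar R.
Hypotheses (mf : measurable_fun setT f) (f0 : forall x, 0 <= f x).

Lemma integral_product_probability1 :
  \int[product_probability]_z f z = \int[P1]_x \int[P2]_y f (x, y).
Proof. exact: fubini_tonelli1. Qed.

Lemma integral_product_probability2 :
  \int[product_probability]_z f z = \int[P2]_y \int[P1]_x f (x, y).
Proof. exact: fubini_tonelli2. Qed.

End integral.
End product_probability.

(** * Tilting and memorylessness of exponential laws *)

Section exponential_integrals.
Local Open Scope ereal_scope.
Context {R : realType}.
Local Notation RM := (measurableTypeR R).
Local Notation expo := (@exponential_law R).
Implicit Types (a b r s y : R) (g k : RM -> \bar R).

Lemma eq_integral_exponential_law r g k : (0 < r)%R ->
  measurable_fun setT g -> measurable_fun setT k ->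
  (forall x, 0 <= g x) -> (forall x, 0 <= k x) ->
  (forall x : R, (0 <= x)%R -> g x = k x) ->
  \int[expo r]_x g x = \int[expo r]_x k x.
Proof.
move=> r0 mg mk g0 k0 gk; rewrite !ge0_integral_exponential_law//.
apply: eq_integral => x _; have [x0|x0] := ltP x 0%R; last by rewrite gk.
by rewrite lt0_exponential_pdf// !mule0.
Qed.

Lemma integral_exponential_law_tilt r s g : (0 < r)%R -> (s < r)%R ->
  measurable_fun setT g -> (forall x, 0 <= g x) ->
  \int[expo r]_x ((expR (s * x))%:E * g x) =
  (r / (r - s))%:E * \int[expo (r - s)]_x g x.
Proof.
move=> r0 sr mg g0; have rs0 : (0 < r - s)%R by rewrite subr_gt0.
have mexp : measurable_fun setT (fun x : RM => (expR (s * x))%:E).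
  have msx : measurable_fun [set: RM] (fun x : R => s * x : R)%R.
    exact: measurable_funM.
  by apply/measurable_EFinP; exact: (measurableT_comp (@measurable_expR R) msx).
have mpdf q : measurable_fun setT (fun x : RM => (exponential_pdf q x)%:E).
  by apply/measurable_EFinP; exact: measurable_exponential_pdf.
rewrite !ge0_integral_exponential_law//; last 2 first.
- exact: emeasurable_funM.
- by move=> x; rewrite mule_ge0// lee_fin expR_ge0.
rewrite -ge0_integralZl_EFin//.
- apply: eq_integral => x _; rewrite muleAC -EFinM exponential_pdf_tilt//.
  by rewrite EFinM muleAC muleA.
- by move=> x _; rewrite mule_ge0// lee_fin exponential_pdf_ge0// ltW.
- exact: emeasurable_funM.
- by rewrite divr_ge0// ltW.
Qed.

(** For g supported on the half-line, the shifted integrand is supported on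
    x >= y, where the density at x is exp(- r y) times the density at x - y. *)
Lemma exponential_law_memoryless r y g : (0 < r)%R -> (0 <= y)%R ->
  measurable_fun setT g -> (forall x, 0 <= g x) ->
  (forall x : R, (x < 0)%R -> g x = 0) ->
  \int[expo r]_x g (x - y)%R = (expR (- (r * y)))%:E * \int[expo r]_x g x.
Proof.
move=> r0 y0 mg g0 gneg.
have mpdf : measurable_fun setT (fun x : RM => (exponential_pdf r x)%:E).
  by apply/measurable_EFinP; exact: measurable_exponential_pdf.
have mgy : measurable_fun setT (fun x : RM => g (x - y)%R).
  by apply: (measurableT_comp mg); exact: measurable_funB.
rewrite !ge0_integral_exponential_law//.
rewrite -(ge0_integral_shift y); last 2 first.
- exact: emeasurable_funM.
- by move=> x; rewrite mule_ge0// lee_fin exponential_pdf_ge0// ltW.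
rewrite -ge0_integralZl_EFin ?expR_ge0//; last 2 first.
- by move=> x _; rewrite mule_ge0// lee_fin exponential_pdf_ge0// ltW.
- exact: emeasurable_funM.
apply: eq_integral => x _; rewrite addrK.
have [x0|x0] := ltP x 0%R; first by rewrite gneg// !mul0e mule0.
rewrite muleCA -EFinM; congr (_ * _%:E).
rewrite !exponential_pdfE ?addr_ge0// mulrCA -expRD; congr (_ * expR _)%R.
by ring.
Qed.

End exponential_integrals.

(** * The Burke property at one corner *)

Section burke.
Local Open Scope ereal_scope.
Context {R : realType}.
Local Notation RM := (measurableTypeR R).
Local Notation expo := (@exponential_law R).
Variables (a b : R).
Hypotheses (a0 : (0 < a)%R) (b0 : (0 < b)%R).
Let ab0 : (0 < a + b)%R. Proof. exact: addr_gt0. Qed.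

(** The half of the Burke property where x - y has a given sign, with s in
    the role of the indicator of that sign and g1, g2, g3 test functions for the three new
    variables. *)
Section half.
Variables (s g1 g2 g3 : RM -> R).
Hypotheses (ms : measurable_fun [set: RM] s) (m1 : measurable_fun [set: RM] g1)
  (m2 : measurable_fun [set: RM] g2) (m3 : measurable_fun [set: RM] g3).
Hypotheses (s0 : forall x, (0 <= s x)%R) (g10 : forall x, (0 <= g1 x)%R)
  (g20 : forall x, (0 <= g2 x)%R) (g30 : forall x, (0 <= g3 x)%R).
Hypothesis sneg : forall x : R, (x < 0)%R -> s x = 0%R.

Let H w := \int[expo a]_x (s x * g1 (w + x))%:E.
Let K w := \int[expo a]_x (s (x - w) * g1 x)%:E.

Let mH : measurable_fun [set: RM] H.
Proof.
pose f (z : RM * RM) : \bar R := (s z.2 * g1 (z.1 + z.2)%R)%:E.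
apply: (measurable_fun_fubini_tonelli_F f); last first.
- by move=> z; rewrite lee_fin mulr_ge0.
- apply/measurable_EFinP; apply: measurable_funM.
  + exact: (measurableT_comp ms).
  + by apply: (measurableT_comp m1); exact: measurable_funD.
Qed.

Let mK : measurable_fun [set: RM] K.
Proof.
pose f (z : RM * RM) : \bar R := (s (z.2 - z.1)%R * g1 z.2)%:E.
apply: (measurable_fun_fubini_tonelli_F f); last first.
- by move=> z; rewrite lee_fin mulr_ge0.
- apply/measurable_EFinP; apply: measurable_funM.
  + by apply: (measurableT_comp ms); exact: measurable_funB.
  + exact: (measurableT_comp m1).
Qed.

Let H0 w : 0 <= H w.
Proof. by apply: integral_ge0 => x _; rewrite lee_fin mulr_ge0. Qed.

Let K0 w : 0 <= K w.
Proof. by apply: integral_ge0 => x _; rewrite lee_fin mulr_ge0. Qed.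

Let mHx (w : R) : measurable_fun [set: RM] (fun x : R => (s x * g1 (w + x))%:E).
Proof.
apply/measurable_EFinP; apply: measurable_funM => //.
by apply: (measurableT_comp m1); exact: measurable_funD.
Qed.

Let HK (w : R) : (0 <= w)%R -> H w = (expR (a * w))%:E * K w.
Proof.
move=> w0; rewrite /K.
pose k (d : RM) : \bar R := (s d * g1 (w + d)%R)%:E.
rewrite (_ : (fun x => _) = (fun x : R => k (x - w)%R)); last first.
  by apply/funext => x; rewrite /k [(w + _)%R]addrC subrK.
rewrite exponential_law_memoryless//; last 3 first.
- exact: (mHx w).
- by move=> x; rewrite lee_fin mulr_ge0.
- by move=> x x0; rewrite /k sneg// mul0r.
by rewrite muleA -EFinM -expRD subrr expR0 mul1e.
Qed.

(** With d = x - y >= 0, the density of (w, d, y) is proportional to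
    exp(- (a + b) w - a d - (a + b) y) on the positive octant. The factor in y is the
    density of the new weight, and the rest is exp(- a (w + d) - b w), the density of
    a pair of independent exponential variables of rates a and b at (w + d, w),
    restricted to the half-plane where the first exceeds the second. *)
Lemma burke_half :
  \int[expo (a + b)]_w \int[expo b]_y \int[expo a]_x
     (s (x - y) * g1 (w + (x - y)) * (g2 w * g3 y))%:E =
  (\int[expo (a + b)]_y (g3 y)%:E) *
  \int[expo b]_y \int[expo a]_x (s (x - y) * g1 x * g2 y)%:E.
Proof.
have m3E : measurable_fun [set: RM] (EFin \o g3) by exact/measurable_EFinP.
have m2E : measurable_fun [set: RM] (EFin \o g2) by exact/measurable_EFinP.
have M30 : 0 <= \int[expo (a + b)]_y (g3 y)%:E.
  by apply: integral_ge0 => y _; rewrite lee_fin.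
(* Memorylessness in x produces exp(- a y), which tilts the law of y to rate a + b. *)
have inner (w : RM) : \int[expo b]_y \int[expo a]_x
     (s (x - y) * g1 (w + (x - y)) * (g2 w * g3 y))%:E =
   (g2 w)%:E * H w * ((b / (a + b))%:E * \int[expo (a + b)]_y (g3 y)%:E).
  transitivity (\int[expo b]_y ((expR ((- a) * y))%:E * ((g2 w)%:E * H w * (g3 y)%:E))).
    apply: eq_integral_exponential_law => //.
    - pose f (z : RM * RM) : \bar R :=
        (s (z.2 - z.1)%R * g1 (w + (z.2 - z.1))%R * (g2 w * g3 z.1))%:E.
      apply: (measurable_fun_fubini_tonelli_F f); last first.
      + by move=> z; rewrite lee_fin !mulr_ge0.
      + have mB : measurable_fun [set: RM * RM] (fun z : R * R => z.2 - z.1 : R)%R.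
          exact: measurable_funB.
        apply/measurable_EFinP; apply: measurable_funM.
          apply: measurable_funM; first exact: (measurableT_comp ms).
          by apply: (measurableT_comp m1); exact: measurable_funD.
        by apply: measurable_funM => //; exact: (measurableT_comp m3).
    - apply: emeasurable_funM.
        have msx : measurable_fun [set: RM] (fun x : R => - a * x : R)%R.
          exact: measurable_funM.
        by apply/measurable_EFinP; exact: (measurableT_comp (@measurable_expR R) msx).
      by apply: emeasurable_funM => //; exact: measurable_cst.
    - by move=> y; apply: integral_ge0 => x _; rewrite lee_fin !mulr_ge0.
    - by move=> y; rewrite !mule_ge0 ?lee_fin ?expR_ge0.
    - move=> y y0.
      under eq_integral do rewrite EFinM.
      rewrite ge0_integralZr//; last 3 first.
      + have mB : measurable_fun [set: RM] (fun z : R => z - y : R)%R.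
          exact: measurable_funB.
        apply/measurable_EFinP; apply: measurable_funM.
          exact: (measurableT_comp ms mB).
        by apply: (measurableT_comp m1); exact: measurable_funD.
      + by move=> x _; rewrite lee_fin mulr_ge0.
      + by rewrite lee_fin mulr_ge0.
      rewrite (@exponential_law_memoryless _ a y (fun d : RM => (s d * g1 (w + d)%R)%:E))//.
      + by rewrite -/(H w) mulNr -muleA EFinM; congr (_ * _); rewrite muleCA muleA.
      + by move=> x; rewrite lee_fin mulr_ge0.
      + by move=> x x0; rewrite sneg// mul0r.
  have mr : measurable_fun [set: RM] (fun y : RM => (g2 w)%:E * H w * (g3 y)%:E).
    by apply: emeasurable_funM => //; exact: measurable_cst.
  rewrite integral_exponential_law_tilt//; last 2 first.
  - by rewrite ltrNl (lt_trans _ a0)// oppr_lt0.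
  - by move=> x; rewrite !mule_ge0 ?lee_fin.
  rewrite opprK [(b + a)%R]addrC ge0_integralZl//; last first.
  - by rewrite mule_ge0 ?lee_fin.
  - by move=> x _; rewrite lee_fin.
  by rewrite muleCA.
under eq_integral do rewrite inner.
rewrite ge0_integralZr//; last 3 first.
- exact: emeasurable_funM.
- by move=> w _; rewrite mule_ge0 ?lee_fin.
- by rewrite mule_ge0// lee_fin divr_ge0 ?ltW.
(* Memorylessness in reverse: exp(a w) tilts the law of w from rate a + b to b. *)
rewrite (_ : \int[_]_x _ =
    \int[expo (a + b)]_w ((expR (a * w))%:E * ((g2 w)%:E * K w))); last first.
  apply: eq_integral_exponential_law => //.
  - exact: emeasurable_funM.
  - apply: emeasurable_funM; last exact: emeasurable_funM.
    have msx : measurable_fun [set: RM] (fun x : R => a * x : R)%R.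
      exact: measurable_funM.
    by apply/measurable_EFinP; exact: (measurableT_comp (@measurable_expR R) msx).
  - by move=> w; rewrite mule_ge0 ?lee_fin.
  - by move=> w; rewrite !mule_ge0 ?lee_fin ?expR_ge0.
  - by move=> w w0; rewrite HK// muleCA.
rewrite integral_exponential_law_tilt//; last 3 first.
- by rewrite ltrDl.
- exact: emeasurable_funM.
- by move=> w; rewrite mule_ge0 ?lee_fin.
have -> : (a + b - a = b)%R by rewrite addrC addKr.
rewrite muleACA -EFinM mulrA divfK ?gt_eqF// divff ?gt_eqF// mul1e muleC.
congr (_ * _); apply: eq_integral => w _; rewrite /K.
rewrite -ge0_integralZl_EFin//.
- by apply: eq_integral => x _; rewrite -EFinM mulrC.
- by move=> x _; rewrite lee_fin mulr_ge0.
- have mB : measurable_fun [set: RM] (fun z : R => z - w : R)%R.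
    exact: measurable_funB.
  apply/measurable_EFinP; apply: measurable_funM => //.
  exact: (measurableT_comp ms mB).
Qed.

End half.
End burke.

Section burke_property.
Local Open Scope ereal_scope.
Context {R : realType}.
Local Notation RM := (measurableTypeR R).
Local Notation expo := (@exponential_law R).
Variables (a b : R).
Hypotheses (a0 : (0 < a)%R) (b0 : (0 < b)%R).

(** Local Burke property: if the horizontal increment x, the vertical increment y and
    the corner weight w are independent of rates a, b and a + b, then the opposite
    increments and the minimum of x and y have the same joint law. The event x = y
    has to be put in one of the two halves: s1 contains it and s2 does not. *)
Lemma burke_exponential (A B C : set RM) :
  measurable A -> measurable B -> measurable C ->
  product_probability (expo (a + b)) (product_probability (expo a) (expo b))
    [set u : RM * (RM * RM) | A (u.1 + Num.max (u.2.1 - u.2.2) 0)%R /\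
      B (u.1 + Num.max (u.2.2 - u.2.1) 0)%R /\ C (Num.min u.2.1 u.2.2)] =
  expo a A * expo b B * expo (a + b) C.
Proof.
move=> mA mB mC; set S := [set u | _].
pose s1 : RM -> R := \1_(`[0%R, +oo[%classic : set RM).
pose s2 : RM -> R := \1_(`]0%R, +oo[%classic : set RM).
have ms1 : measurable_fun [set: RM] s1.
  by apply: measurable_indic; exact: measurable_itv.
have ms2 : measurable_fun [set: RM] s2.
  by apply: measurable_indic; exact: measurable_itv.
pose F1 (w x y : RM) : R := (s1 (x - y) * \1_A (w + (x - y)) * (\1_B w * \1_C y))%R.
pose F2 (w x y : RM) : R := (s2 (y - x) * \1_B (w + (y - x)) * (\1_A w * \1_C x))%R.
pose G1 (u : RM * (RM * RM)) : \bar R := (F1 u.1 u.2.1 u.2.2)%:E.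
pose G2 (u : RM * (RM * RM)) : \bar R := (F2 u.1 u.2.1 u.2.2)%:E.
have G10 u : 0 <= G1 u by rewrite lee_fin !mulr_ge0.
have G20 u : 0 <= G2 u by rewrite lee_fin !mulr_ge0.
have mw : measurable_fun [set: RM * (RM * RM)] (fun u : R * (R * R) => u.1 : R).
  exact: measurable_fst.
have mx : measurable_fun [set: RM * (RM * RM)] (fun u : R * (R * R) => u.2.1 : R).
  exact: (measurableT_comp measurable_fst measurable_snd).
have my : measurable_fun [set: RM * (RM * RM)] (fun u : R * (R * R) => u.2.2 : R).
  exact: (measurableT_comp measurable_snd measurable_snd).
have mI (D : set RM) : measurable D -> measurable_fun [set: RM] (\1_D : RM -> R).
  exact: measurable_indic.
have mG1 : measurable_fun setT G1.
  have mxy := measurable_funB mx my.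
  apply/measurable_EFinP; apply: measurable_funM; apply: measurable_funM.
  - exact: (measurableT_comp ms1 mxy).
  - exact: (measurableT_comp (mI _ mA) (measurable_funD mw mxy)).
  - exact: (measurableT_comp (mI _ mB) mw).
  - exact: (measurableT_comp (mI _ mC) my).
have mG2 : measurable_fun setT G2.
  have mxy := measurable_funB my mx.
  apply/measurable_EFinP; apply: measurable_funM; apply: measurable_funM.
  - exact: (measurableT_comp ms2 mxy).
  - exact: (measurableT_comp (mI _ mB) (measurable_funD mw mxy)).
  - exact: (measurableT_comp (mI _ mA) mw).
  - exact: (measurableT_comp (mI _ mC) mx).
have s1E (x : R) : s1 x = ((0 <= x)%R)%:R%R.
  by rewrite /s1 indicE mem_setE in_itv/= andbT.
have s2E (x : R) : s2 x = ((0 < x)%R)%:R%R.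
  by rewrite /s2 indicE mem_setE in_itv/= andbT.
have SE u : (\1_S u)%:E = G1 u + G2 u.
  case: u => w [x y]; rewrite /G1 /G2 /F1 /F2 /= s1E s2E -EFinD; congr EFin.
  have SE : \1_S (w, (x, y)) = (\1_A (w + Num.max (x - y) 0) *
     (\1_B (w + Num.max (y - x) 0) * \1_C (Num.min x y)))%R :> R.
    rewrite !indicE -!natrM !mulnb; congr (nat_of_bool _)%:R%R.
    apply/idP/idP => [/set_mem[/= ? [? ?]]|/and3P[/set_mem ? /set_mem ? /set_mem ?]].
      by apply/and3P; split; exact/mem_set.
    by apply/mem_set.
  rewrite SE; have [yx|xy] := leP y x.
  - rewrite subr_ge0 yx subr_gt0 ltNge yx/= !mul0r addr0 mul1r.
    rewrite max_l ?subr_ge0// max_r ?subr_le0// addr0.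
    by [].
  - rewrite subr_ge0 leNgt xy subr_gt0 xy/= !mul0r add0r mul1r.
    rewrite max_r ?subr_le0 ?ltW// max_l ?subr_ge0 ?ltW// addr0.
    by rewrite mulrCA.
have mS : measurable S.
  have -> : S = (fun u => G1 u + G2 u) @^-1` [set 1].
    apply/seteqP; split=> u.
      by move=> Su; rewrite /= -SE indicE mem_set.
    rewrite /= -SE indicE; case: (boolP (u \in S)) => [/set_mem//|_] [] /eqP.
    by rewrite eq_sym oner_eq0.
  rewrite -[X in measurable X]setTI; apply: emeasurable_funD => //.
rewrite -[S in LHS]setIT -integral_indic//.
under eq_integral do rewrite SE.
rewrite ge0_integralD//.
rewrite !integral_product_probability1//.
have -> : \int[expo (a + b)]_w
    \int[product_probability (expo a) (expo b)]_v G1 (w, v) =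
  \int[expo (a + b)]_w \int[expo b]_y \int[expo a]_x (F1 w x y)%:E.
  apply: eq_integral => w _.
  rewrite integral_product_probability2//.
  exact: (measurableT_comp mG1).
have -> : \int[expo (a + b)]_w
    \int[product_probability (expo a) (expo b)]_v G2 (w, v) =
  \int[expo (b + a)]_w \int[expo a]_x \int[expo b]_y (F2 w x y)%:E.
  rewrite addrC; apply: eq_integral => w _.
  rewrite integral_product_probability1//.
  exact: (measurableT_comp mG2).
rewrite !burke_half//; last 2 first.
- by move=> x x0; rewrite s2E ltNge ltW.
- by move=> x x0; rewrite s1E leNgt x0.
rewrite (addrC b a) !integral_indic// !setIT.
pose f1 (v : RM * RM) : \bar R := (s1 (v.1 - v.2) * \1_A v.1 * \1_B v.2)%:E.
pose f2 (v : RM * RM) : \bar R := (s2 (v.2 - v.1) * \1_B v.2 * \1_A v.1)%:E.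
have mf1 : measurable_fun setT f1.
  have mxy : measurable_fun [set: RM * RM] (fun v : R * R => v.1 - v.2 : R)%R.
    exact: measurable_funB.
  apply/measurable_EFinP; apply: measurable_funM; first apply: measurable_funM.
  - exact: (measurableT_comp ms1 mxy).
  - exact: (measurableT_comp (mI _ mA) measurable_fst).
  - exact: (measurableT_comp (mI _ mB) measurable_snd).
have mf2 : measurable_fun setT f2.
  have mxy : measurable_fun [set: RM * RM] (fun v : R * R => v.2 - v.1 : R)%R.
    exact: measurable_funB.
  apply/measurable_EFinP; apply: measurable_funM; first apply: measurable_funM.
  - exact: (measurableT_comp ms2 mxy).
  - exact: (measurableT_comp (mI _ mB) measurable_snd).
  - exact: (measurableT_comp (mI _ mA) measurable_fst).
have f10 v : 0 <= f1 v by rewrite lee_fin !mulr_ge0.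
have f20 v : 0 <= f2 v by rewrite lee_fin !mulr_ge0.
transitivity (expo (a + b) C *
    (\int[product_probability (expo a) (expo b)]_v f1 v +
     \int[product_probability (expo a) (expo b)]_v f2 v)).
  rewrite [RHS]ge0_muleDr ?integral_ge0//.
  by rewrite (integral_product_probability2 _ _ mf1 f10)
    (integral_product_probability1 _ _ mf2 f20).
rewrite muleC; congr (_ * _).
transitivity (\int[product_probability (expo a) (expo b)]_v (f1 v + f2 v)).
  by rewrite [RHS]ge0_integralD.
rewrite -product_probabilityX// -[A `*` B]setIT -integral_indic//; last first.
  exact: measurableX.
apply: eq_integral => -[x y] _; rewrite /f1 /f2 /= s1E s2E -EFinD; congr EFin.
have -> : \1_(A `*` B) (x, y) = (\1_A x * \1_B y)%R :> R.
  rewrite !indicE -natrM mulnb; congr (nat_of_bool _)%:R%R.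
  apply/idP/idP => [/set_mem[/= ? ?]|/andP[/set_mem ? /set_mem ?]].
    by apply/andP; split; exact/mem_set.
  exact/mem_set.
have [yx|xy] := leP y x.
- by rewrite subr_ge0 yx subr_gt0 ltNge yx/= !mul0r addr0 mul1r.
- by rewrite subr_ge0 leNgt xy subr_gt0 xy/= !mul0r add0r mul1r mulrC.
Qed.

End burke_property.

(** * Independent families with prescribed laws *)

Section restricted_law.
Local Open Scope ereal_scope.
Context d d' (Omega : measurableType d) (T : measurableType d') (R : realType).
Variables (P : {measure set Omega -> \bar R}) (E : set Omega) (Y : Omega -> T).
Hypotheses (mE : measurable E) (mY : measurable_fun setT Y).

Definition restricted_law of measurable E & measurable_fun setT Y :=
  fun S : set T => P (Y @^-1` S `&` E).
Local Notation nu := (restricted_law mE mY).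

Let mYS S : measurable S -> measurable (Y @^-1` S).
Proof. by move=> mS; rewrite -[X in measurable X]setTI; exact: mY. Qed.

Let nu0 : nu set0 = 0.
Proof. by rewrite /restricted_law preimage_set0 set0I measure0. Qed.

Let nu_ge0 S : 0 <= nu S.
Proof. exact: measure_ge0. Qed.

Let nu_sigma_additive : semi_sigma_additive nu.
Proof.
move=> F mF tF mUF; rewrite /restricted_law preimage_bigcup setI_bigcupl.
apply: measure_semi_sigma_additive.
- by move=> n; apply: measurableI => //; exact: mYS.
- apply: trivIset_setIr; apply/trivIsetP => /= i j _ _ ij; rewrite -preimage_setI.
  by move/trivIsetP : tF => /(_ _ _ _ _ ij) ->//; rewrite preimage_set0.
- rewrite -setI_bigcupl -preimage_bigcup; apply: measurableI => //.
  exact: mYS.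
Qed.

HB.instance Definition _ := isMeasure.Build _ _ _ nu nu0 nu_ge0 nu_sigma_additive.

End restricted_law.

Section independence.
Local Open Scope ereal_scope.
Context d (Omega : measurableType d) (R : realType) (I : eqType).
Local Notation RM := (measurableTypeR R).
Implicit Types (P : {measure set Omega -> \bar R}) (X : Omega -> I -> R)
  (mu : I -> probability RM R) (s : seq I) (B : I -> set RM).

Definition cylinder X s B : set Omega := [set t | forall i, i \in s -> B i (X t i)].

(** P is only a measure, so that the definition applies to a change of measure before
    its total mass is known; the empty s forces this mass to be 1. *)
Definition independent_with_laws P mu X : Prop :=
  (forall i, measurable_fun setT (fun t => X t i : RM)) /\
  forall s B, uniq s -> (forall i, measurable (B i)) ->
    P (cylinder X s B) = \prod_(i <- s) mu i (B i).

Lemma cylinder_nil X B : cylinder X [::] B = setT.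
Proof. by apply/seteqP; split. Qed.

Lemma cylinder_cons X i s B :
  cylinder X (i :: s) B = (fun t => X t i) @^-1` B i `&` cylinder X s B.
Proof.
apply/seteqP; split => [t h|t [hi h] j].
  by split => [|j js]; apply: h; rewrite inE ?eqxx ?js ?orbT.
by rewrite inE => /orP[/eqP ->//|/h].
Qed.

Lemma eq_cylinder X s s' B B' : s =i s' -> {in s, B =1 B'} ->
  cylinder X s B = cylinder X s' B'.
Proof.
move=> ss' BB'; apply/seteqP; split => t h i is_.
  by rewrite -BB' ?ss'//; apply: h; rewrite ss'.
by rewrite BB'//; apply: h; rewrite -ss'.
Qed.

Lemma measurable_cylinder X s B :
  (forall i, measurable_fun setT (fun t => X t i : RM)) ->
  (forall i, measurable (B i)) -> measurable (cylinder X s B).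
Proof.
move=> mX mB; elim: s => [|i s IH]; first by rewrite cylinder_nil.
rewrite cylinder_cons; apply: measurableI => //.
by rewrite -[X in measurable X]setTI; exact: mX.
Qed.

(** An index that carries no constraint can be added to a cylinder with the full set
    as constraint, which contributes a factor 1. *)
Lemma independent_with_laws_enlarge P mu X (s0 : seq I) :
  (forall i, measurable_fun setT (fun t => X t i : RM)) ->
  (forall s B, uniq s -> {subset s0 <= s} -> (forall i, measurable (B i)) ->
    P (cylinder X s B) = \prod_(i <- s) mu i (B i)) ->
  independent_with_laws P mu X.
Proof.
move=> mX H; split=> // s B us mB.
pose B' i := if i \in s then B i else setT.
pose r := [seq i <- undup s0 | i \notin s].
have cE : cylinder X s B = cylinder X (s ++ r) B'.
  apply/seteqP; split=> t h i; last first.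
    by move=> is_; have := h i; rewrite mem_cat is_ /B' is_ => /(_ isT).
  by rewrite mem_cat /B'; case: ifPn => // is_ _; exact: h.
rewrite cE H.
- rewrite big_cat/= [X in _ * X]big1_seq ?mule1; last first.
    move=> i /=; rewrite mem_filter => /andP[/negbTE is_ _].
    by rewrite /B' is_ probability_setT.
  by apply: eq_big_seq => i is_; rewrite /B' is_.
- rewrite cat_uniq us filter_uniq ?undup_uniq// andbT.
  by apply/hasPn => i; rewrite mem_filter => /andP[].
- by move=> i i0; rewrite mem_cat mem_filter mem_undup i0 andbT orbN.
- by move=> i; rewrite /B'; case: ifP.
Qed.

(** Independence is stated with rectangles; two uses of the uniqueness of product
    measures extend it to any event of three of the variables. *)
Lemma independent_with_laws_indep3 P mu X a b c s B (S : set (RM * (RM * RM))) :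
  independent_with_laws P mu X -> uniq [:: a, b, c & s] ->
  (forall i, measurable (B i)) -> measurable S ->
  P ([set t | S (X t c, (X t a, X t b))] `&` cylinder X s B) =
  P (cylinder X s B) *
    product_probability (mu c) (product_probability (mu a) (mu b)) S.
Proof.
move=> [mX iX] us mB mS.
have us3 : uniq s by case/and4P: us.
pose E := cylinder X s B; pose cE := (\prod_(i <- s) fine (mu i (B i)))%R.
have mE : measurable E by exact: measurable_cylinder.
have fmu i A : measurable A -> mu i A = (fine (mu i A))%:E.
  by move=> mA; rewrite fineK// fin_num_measure.
have cEE : P E = cE%:E.
  by rewrite iX// /cE -prodEFin; apply: eq_bigr => i _; rewrite fmu.
have cE0 : (0 <= cE)%R by rewrite -lee_fin -cEE.
have mZ : measurable_fun setT (fun t => (X t c, (X t a, X t b)) : RM * (RM * RM)).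
  by apply: measurable_fun_pair => //; apply: measurable_fun_pair.
have mY : measurable_fun setT (fun t => (X t a, X t b) : RM * RM).
  exact: measurable_fun_pair.
rewrite -/E cEE.
apply: (@product_probability_unique _ _ _ _ _ (mu c)
  (product_probability (mu a) (mu b)) (restricted_law P mE mZ)) => // C D mC mD.
have mE' : measurable ((fun t => X t c) @^-1` C `&` E).
  by apply: measurableI => //; rewrite -[X in measurable X]setTI; exact: mX.
transitivity (restricted_law P mE' mY D).
  rewrite /= /restricted_law; congr (P _); apply/seteqP; split => t /=.
    by move=> [[? ?] ?].
  by move=> [? [? ?]].
rewrite muleA (fmu c)// -EFinM.
apply: (@product_probability_unique _ _ _ _ _ (mu a) (mu b)) => //.
  by rewrite mulr_ge0// fine_ge0.
move=> A A' mA mA'.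
pose B' i : set RM := if i == a then A else if i == b then A' else
  if i == c then C else B i.
move: us; rewrite /= !inE !negb_or => /and4P[/and3P[ab ac ans] /andP[bc bns] cns _].
have B'E : {in s, B' =1 B}.
  move=> i is_; rewrite /B'.
  case: eqP => [ia|_]; first by rewrite -ia is_ in ans.
  case: eqP => [ia|_]; first by rewrite -ia is_ in bns.
  by case: eqP => [ia|_] //; rewrite -ia is_ in cns.
have B'a : B' a = A by rewrite /B' eqxx.
have B'b : B' b = A' by rewrite /B' eq_sym (negbTE ab) eqxx.
have B'c : B' c = C.
  by rewrite /B' eq_sym (negbTE ac) eq_sym (negbTE bc) eqxx.
transitivity (P (cylinder X [:: a, b, c & s] B')).
  rewrite !cylinder_cons B'a B'b B'c (eq_cylinder _ (fun=> erefl) B'E).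
  rewrite /= /restricted_law; congr (P _); apply/seteqP; split => t /=.
    by move=> [[? ?] [? ?]].
  by move=> [? [? [? ?]]].
rewrite iX//; last 2 first.
- by rewrite /= !inE !negb_or ab ac ans bc bns cns.
- by move=> i; rewrite /B'; do 3 case: ifP => // _.
rewrite !big_cons B'a B'b B'c (eq_big_seq _ (fun i is_ => congr1 _ (B'E i is_))).
rewrite -iX// -/E cEE [in LHS](fmu a)// [in LHS](fmu b)// [in LHS](fmu c)//.
rewrite [in RHS](fmu a)// [in RHS](fmu b)// -!EFinM; congr EFin; ring.
Qed.

End independence.

(** * Corner flips preserve independence *)

Section flip.
Local Open Scope ereal_scope.
Context d (Omega : measurableType d) (R : realType) (I : eqType).
Local Notation RM := (measurableTypeR R).
Local Notation expo := (@exponential_law R).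

(** The variables keep their places: a and b are the slots of the horizontal and
    vertical increments and c is the slot of the corner weight, so that a whole
    column can be processed by flips that act on one family. *)
Definition burke_flip (a b c : I) (x : I -> R) : I -> R := fun i =>
  (if i == a then x c + Num.max (x a - x b) 0
   else if i == b then x c + Num.max (x b - x a) 0
   else if i == c then Num.min (x a) (x b) else x i)%R.

Lemma independent_burke_flip (P : {measure set Omega -> \bar R}) (X : Omega -> I -> R)
    (mu : I -> probability RM R) (a b c : I) (r q : R) :
  (0 < r)%R -> (0 < q)%R -> uniq [:: a; b; c] ->
  mu a = expo r -> mu b = expo q -> mu c = expo (r + q)%R ->
  independent_with_laws P mu X ->
  independent_with_laws P mu (fun t => burke_flip a b c (X t)).
Proof.
move=> r0 q0 uabc mua mub muc iX; have [mX _] := iX.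
apply: (@independent_with_laws_enlarge _ _ _ _ _ _ _ [:: a; b; c]).
  have mXR i : measurable_fun setT (fun t => X t i : R) by exact: mX.
  have mmax (i j : I) :
      measurable_fun setT (fun t => Num.max (X t i - X t j) 0 : R)%R.
    by apply: measurable_maxr => //; exact: measurable_funB.
  move=> i; rewrite /burke_flip.
  case: eqP => _; first exact: (measurable_funD (mXR c) (mmax a b)).
  case: eqP => _; first exact: (measurable_funD (mXR c) (mmax b a)).
  by case: eqP => _ //; exact: (measurable_minr (mXR a) (mXR b)).
move=> s B us sabc mB.
pose rest := [seq i <- s | i \notin [:: a; b; c]].
have sE : perm_eq s [:: a, b, c & rest].
  apply: uniq_perm => //.
    rewrite -[X in uniq X]/([:: a; b; c] ++ rest) cat_uniq uabc filter_uniq// andbT.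
    by apply/hasPn => i; rewrite mem_filter => /andP[].
  move=> i; rewrite -[X in _ = (_ \in X)]/([:: a; b; c] ++ rest) mem_cat mem_filter.
  by case: (boolP (i \in [:: a; b; c])) => //= /sabc.
pose S : set (RM * (RM * RM)) := [set u | B a (u.1 + Num.max (u.2.1 - u.2.2) 0)%R /\
      B b (u.1 + Num.max (u.2.2 - u.2.1) 0)%R /\ B c (Num.min u.2.1 u.2.2)].
have mS : measurable S.
  have mw : measurable_fun [set: RM * (RM * RM)] (fun u : R * (R * R) => u.1 : R).
    exact: measurable_fst.
  have mx : measurable_fun [set: RM * (RM * RM)] (fun u : R * (R * R) => u.2.1 : R).
    exact: (measurableT_comp measurable_fst measurable_snd).
  have my : measurable_fun [set: RM * (RM * RM)] (fun u : R * (R * R) => u.2.2 : R).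
    exact: (measurableT_comp measurable_snd measurable_snd).
  have mxy : measurable_fun [set: RM * (RM * RM)]
      (fun u : R * (R * R) => u.1 + Num.max (u.2.1 - u.2.2) 0 : R)%R.
    apply: measurable_funD => //; apply: measurable_maxr => //.
    exact: measurable_funB.
  have myx : measurable_fun [set: RM * (RM * RM)]
      (fun u : R * (R * R) => u.1 + Num.max (u.2.2 - u.2.1) 0 : R)%R.
    apply: measurable_funD => //; apply: measurable_maxr => //.
    exact: measurable_funB.
  have mmin : measurable_fun [set: RM * (RM * RM)]
      (fun u : R * (R * R) => Num.min u.2.1 u.2.2 : R)%R.
    exact: measurable_minr.
  apply: measurableI; last apply: measurableI.
  - by have := mxy measurableT _ (mB a); rewrite setTI.
  - by have := myx measurableT _ (mB b); rewrite setTI.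
  - by have := mmin measurableT _ (mB c); rewrite setTI.
have [/= ab ac bc] : [/\ a != b, a != c & b != c].
  by move: uabc; rewrite /= !inE negb_or andbT => /andP[/andP[-> ->] ->].
have urest : uniq [:: a, b, c & rest] by rewrite -(perm_uniq sE).
have [/negbTE arest /negbTE brest /negbTE crest] :
    [/\ a \notin rest, b \notin rest & c \notin rest].
  by rewrite !mem_filter !inE !eqxx ?orbT.
have -> : cylinder (fun t => burke_flip a b c (X t)) s B =
    [set t | S (X t c, (X t a, X t b))] `&` cylinder X rest B.
  rewrite (eq_cylinder _ (perm_mem sE) (fun _ _ => erefl)) !cylinder_cons.
  have -> : cylinder (fun t => burke_flip a b c (X t)) rest B = cylinder X rest B.
    have ri (i : I) : i \in rest -> forall t, burke_flip a b c (X t) i = X t i.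
      move=> ir t; rewrite /burke_flip.
      case: eqP => [ia|_]; first by rewrite -ia ir in arest.
      case: eqP => [ia|_]; first by rewrite -ia ir in brest.
      by case: eqP => [ia|_] //; rewrite -ia ir in crest.
    by apply/seteqP; split => t h i ir; have := h i ir; rewrite ri.
  rewrite !setIA; congr (_ `&` _).
  apply/seteqP; split => t; rewrite /S /= /burke_flip !eqxx.
    by rewrite [b == a]eq_sym [c == a]eq_sym [c == b]eq_sym (negbTE ab) (negbTE ac)
      (negbTE bc) => -[[? ?] ?].
  by rewrite [b == a]eq_sym [c == a]eq_sym [c == b]eq_sym (negbTE ab) (negbTE ac)
      (negbTE bc) => -[? [? ?]].
rewrite (independent_with_laws_indep3 iX urest mB mS) mua mub muc.
rewrite burke_exponential// (perm_big _ sE)/= !big_cons mua mub muc.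
by rewrite iX.2//; [rewrite muleC !muleA|move: urest => /and4P[]].
Qed.

End flip.

(** * Expectations of products and tilted families *)

Section product_expectation.
Local Open Scope ereal_scope.
Context d (Omega : measurableType d) (R : realType).
Local Notation RM := (measurableTypeR R).
Implicit Types (P : {measure set Omega -> \bar R}).

(** The hypothesis identifies the image under X of the measure of density h. *)
Lemma integral_of_indicators P (X : Omega -> RM) (h : Omega -> R)
    (mu : probability RM R) (c : R) :
  measurable_fun setT X -> measurable_fun setT h -> (forall t, (0 <= h t)%R) ->
  (0 <= c)%R ->
  (forall B, measurable B -> \int[P]_t (h t * \1_B (X t))%:E = c%:E * mu B) ->
  forall g : RM -> R, measurable_fun setT g -> (forall x, (0 <= g x)%R) ->
  \int[P]_t (h t * g (X t))%:E = c%:E * \int[mu]_x (g x)%:E.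
Proof.
move=> mX mh h0 c0 H g mg g0.
have mgX : measurable_fun setT (fun t => (g (X t))%:E).
  by apply/measurable_EFinP; exact: (measurableT_comp mg mX).
have mgE : measurable_fun setT (EFin \o g) by exact/measurable_EFinP.
transitivity (\int[density_measure P mh h0]_t (g (X t))%:E).
  rewrite ge0_integral_density//; last by move=> t; rewrite lee_fin.
  by apply: eq_integral => t _; rewrite -EFinM mulrC.
transitivity (\int[pushforward (density_measure P mh h0) X]_x (g x)%:E).
  by rewrite ge0_integral_pushforward// => x _; rewrite lee_fin.
transitivity (\int[mscale (NngNum c0) mu]_x (g x)%:E); last first.
  by rewrite ge0_integral_mscale// => x _; rewrite lee_fin.
apply: eq_measure_integral => B mB _.
transitivity (c%:E * mu B); last by [].
transitivity (\int[P]_(t in X @^-1` B) (h t)%:E); first by [].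
rewrite -H// integral_mkcond.
apply: eq_integral => t _; rewrite /= patchE indicE.
have -> : (t \in X @^-1` B) = (X t \in B) by apply/idP/idP => /set_mem ?; exact/mem_set.
by case: ifP; rewrite ?mulr1 ?mulr0.
Qed.

Context (I : eqType).
Implicit Types (X : Omega -> I -> R) (mu : I -> probability RM R) (s : seq I).

(** The indicator of a cylinder makes the induction work: a factor g i passes from
    the product to the cylinder by testing it on indicator functions. *)
Lemma expectation_prod_cylinder P mu X (g : I -> RM -> R) (c : I -> R) s u
    (B : I -> set RM) :
  independent_with_laws P mu X ->
  (forall i, measurable_fun setT (g i)) -> (forall i x, (0 <= g i x)%R) ->
  (forall i, \int[mu i]_x (g i x)%:E = (c i)%:E) ->
  uniq (s ++ u) -> (forall i, measurable (B i)) ->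
  \int[P]_t ((\prod_(i <- s) g i (X t i)) * \1_(cylinder X u B) t)%:E =
  (\prod_(i <- s) c i)%:E * \prod_(i <- u) mu i (B i).
Proof.
move=> [mX iX] mg g0 gc; have c0 i : (0 <= c i)%R.
  by rewrite -lee_fin -gc integral_ge0// => x _; rewrite lee_fin.
elim: s u B => [|i s IH] u B us mB.
  rewrite big_nil mul1e; under eq_integral do rewrite big_nil mul1r.
  rewrite integral_indic ?setIT; [|by []|exact: measurable_cylinder].
  exact: iX.
have muE j A : measurable A -> mu j A = (fine (mu j A))%:E.
  by move=> mA; rewrite fineK// fin_num_measure.
pose h t := ((\prod_(i <- s) g i (X t i)) * \1_(cylinder X u B) t)%R.
pose k := ((\prod_(i <- s) c i) * \prod_(i <- u) fine (mu i (B i)))%R.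
have kE : (\prod_(i <- s) c i)%:E * \prod_(i <- u) mu i (B i) = k%:E.
  by rewrite /k EFinM; congr (_ * _); rewrite -prodEFin; apply: eq_bigr => j _; rewrite -muE.
under eq_integral do rewrite big_cons -mulrA mulrC.
rewrite big_cons EFinM -muleA kE muleC -gc.
apply: (@integral_of_indicators P (fun t => X t i) h (mu i) k) => //.
- apply: measurable_funM.
    apply: measurable_prod => j _.
    exact: (measurableT_comp (mg j) (mX j)).
  by apply: measurable_indic; exact: measurable_cylinder.
- by move=> t; rewrite mulr_ge0// prodr_ge0.
- by rewrite mulr_ge0 ?prodr_ge0// => j _; rewrite fine_ge0.
move=> A mA; pose B' j := if j == i then A else B j.
have uisu : uniq (s ++ i :: u) by rewrite -cat1s uniq_catCA.
have iu : i \notin u by move: us; rewrite /= mem_cat negb_or => /andP[/andP[]].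
have B'u : {in u, B' =1 B}.
  by move=> j ju; rewrite /B'; case: eqP => // ji; rewrite -ji ju in iu.
have mB' j : measurable (B' j) by rewrite /B'; case: ifP.
have B'i : B' i = A by rewrite /B' eqxx.
have := IH (i :: u) B' uisu mB'.
rewrite big_cons (eq_big_seq _ (fun j ju => congr1 _ (B'u j ju))).
rewrite B'i muleCA kE muleC => <-.
apply: eq_integral => t _; rewrite /h -mulrA; congr (_ * _)%:E.
rewrite cylinder_cons B'i (eq_cylinder _ (fun=> erefl) B'u).
rewrite !indicE -natrM mulnb; congr (nat_of_bool _)%:R%R.
apply/andP/idP => [[/set_mem ? /set_mem ?]|/set_mem[? ?]].
  by apply/mem_set.
by split; exact/mem_set.
Qed.

Lemma expectation_prod P mu X (g : I -> RM -> R) (c : I -> R) s :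
  independent_with_laws P mu X ->
  (forall i, measurable_fun setT (g i)) -> (forall i x, (0 <= g i x)%R) ->
  (forall i, \int[mu i]_x (g i x)%:E = (c i)%:E) -> uniq s ->
  \int[P]_t (\prod_(i <- s) g i (X t i))%:E = (\prod_(i <- s) c i)%:E.
Proof.
move=> iX mg g0 gc us.
have := @expectation_prod_cylinder P mu X g c s [::] (fun=> setT) iX mg g0 gc.
rewrite cats0 big_nil mule1 cylinder_nil => <-//.
by apply: eq_integral => t _; rewrite indicE in_setT mulr1.
Qed.

End product_expectation.

Section tilting.
Local Open Scope ereal_scope.
Context d (Omega : measurableType d) (R : realType) (I : eqType).
Local Notation RM := (measurableTypeR R).

(** A density that is a product over the indices changes each law separately. *)
Lemma independent_tilt (P : {measure set Omega -> \bar R}) (X : Omega -> I -> R)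
    (mu nu : I -> probability RM R) (g : I -> RM -> R) (s0 : seq I)
    (mD : measurable_fun setT (fun t => \prod_(i <- s0) g i (X t i))%R)
    (D0 : forall t, (0 <= \prod_(i <- s0) g i (X t i))%R) :
  independent_with_laws P mu X -> uniq s0 ->
  (forall i, measurable_fun setT (g i)) -> (forall i x, (0 <= g i x)%R) ->
  (forall i, i \notin s0 -> forall x, g i x = 1%R) ->
  (forall i B, measurable B -> \int[mu i]_x (g i x * \1_B x)%:E = nu i B) ->
  independent_with_laws (density_measure P mD D0) nu X.
Proof.
move=> iX us0 mg g0 g1 gnu; have mX := iX.1.
apply: (@independent_with_laws_enlarge _ _ _ _ _ _ _ s0) => // s B us s0s mB.
rewrite /= /density_measure integral_mkcond.
pose g' i x := (g i x * \1_(B i) x)%R.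
transitivity (\int[P]_t (\prod_(i <- s) g' i (X t i))%:E).
  apply: eq_integral => t _; rewrite patchE.
  have -> : (\prod_(i <- s) g' i (X t i) =
      (\prod_(i <- s0) g i (X t i)) * \1_(cylinder X s B) t)%R.
    rewrite big_split /=; congr (_ * _)%R.
      have sE : perm_eq s (s0 ++ [seq i <- s | i \notin s0]).
        apply: uniq_perm => //.
          rewrite cat_uniq us0 filter_uniq// andbT.
          by apply/hasPn => i; rewrite mem_filter => /andP[].
        move=> i; rewrite mem_cat mem_filter.
        by case: (boolP (i \in s0)) => //= /s0s.
      rewrite (perm_big _ sE)/= big_cat/= [X in (_ * X)%R]big1_seq ?mulr1// => i.
      by rewrite mem_filter => /andP[_ /andP[? _]]; exact: g1.
    elim: (s) => [|i r IH]; first by rewrite big_nil cylinder_nil indicE in_setT.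
    rewrite big_cons IH cylinder_cons !indicE -natrM mulnb.
    congr (nat_of_bool _)%:R%R.
    apply/andP/idP => [[/set_mem ? /set_mem ?]|/set_mem[? ?]].
      by apply/mem_set.
    by split; exact/mem_set.
  by rewrite indicE; case: ifP; rewrite ?mulr1 ?mulr0.
rewrite (expectation_prod (c := fun i => fine (nu i (B i))) iX)//.
- rewrite -prodEFin; apply: eq_bigr => i _.
  by rewrite fineK// fin_num_measure.
- by move=> i; apply: measurable_funM => //; exact: measurable_indic.
- by move=> i x; rewrite /g' mulr_ge0.
- by move=> i; rewrite gnu// fineK// fin_num_measure.
Qed.

End tilting.

(** * Last-passage times and their increments *)

Section last_passage_increments.
Context {R : realType}.
Implicit Types (x : nat * nat -> R) (i j k n : nat).

(** The last-passage time from the origin to (i, j), in the quadrant with both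
    boundaries and without weight at the origin. *)
Fixpoint lpp x i : nat -> R :=
  match i with
  | 0%N => fun j => \sum_(k < j) x (0%N, k.+1)
  | i'.+1 => fix column j : R :=
      match j with
      | 0%N => lpp x i' 0%N + x (i'.+1, 0%N)
      | j'.+1 => x (i'.+1, j'.+1) + Num.max (lpp x i' j'.+1) (column j')
      end
  end.

Lemma lpp00 x : lpp x 0 0 = 0.
Proof. by rewrite /= big_ord0. Qed.

Lemma lpp0S x j : lpp x 0 j.+1 = lpp x 0 j + x (0%N, j.+1).
Proof. by rewrite /= big_ord_recr. Qed.

Lemma lppS0 x i : lpp x i.+1 0 = lpp x i 0 + x (i.+1, 0%N).
Proof. by []. Qed.

Lemma lppSS x i j :
  lpp x i.+1 j.+1 = x (i.+1, j.+1) + Num.max (lpp x i j.+1) (lpp x i.+1 j).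
Proof. by []. Qed.

Lemma lpp_row0 x i : lpp x i 0 = \sum_(k < i) x (k.+1, 0%N).
Proof. by elim: i => [|i IH]; rewrite ?lpp00 ?big_ord0// lppS0 IH big_ord_recr. Qed.

(** [sweep_column i k] flips the k lowest corners between columns i and i + 1, from
    the bottom up: the slot (i + 1, 0) carries the horizontal increment upwards, and
    the slots (0, j + 1) receive the vertical increments of the new column. *)
Fixpoint sweep_column i k x : nat * nat -> R :=
  if k is k'.+1 then
    burke_flip (i.+1, 0%N) (0%N, k'.+1) (i.+1, k'.+1) (sweep_column i k' x)
  else x.

Fixpoint sweep n i x : nat * nat -> R :=
  if i is i'.+1 then sweep_column i' n (sweep n i' x) else x.

(** G0 and G1 are the last-passage times along columns i and i + 1. A flip is the
    recursion for G1 rewritten for increments. *)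
Lemma sweep_columnE x i n (G0 G1 : nat -> R) k : (k <= n)%N ->
  (forall j, (j < n)%N -> x (0%N, j.+1) = G0 j.+1 - G0 j) ->
  x (i.+1, 0%N) = G1 0%N - G0 0%N ->
  (forall j, (j < n)%N -> G1 j.+1 = x (i.+1, j.+1) + Num.max (G0 j.+1) (G1 j)) ->
  [/\ forall j, (j < k)%N -> sweep_column i k x (0%N, j.+1) = G1 j.+1 - G1 j,
      forall j, (k <= j)%N -> sweep_column i k x (0%N, j.+1) = x (0%N, j.+1),
      sweep_column i k x (i.+1, 0%N) = G1 k - G0 k &
      forall q, (i < q.1)%N -> (i.+1 < q.1)%N || (k < q.2)%N ->
        sweep_column i k x q = x q].
Proof.
move=> + x0 xi xb; elim: k => [_|k IH kn]; first by split=> //= -[].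
have [IH1 IH2 IH3 IH4] := IH (ltnW kn); rewrite /=.
set y := sweep_column i k x in IH1 IH2 IH3 IH4 *.
have yk : y (0%N, k.+1) = G0 k.+1 - G0 k by rewrite IH2// x0.
have yi : y (i.+1, k.+1) = x (i.+1, k.+1) by rewrite IH4//= ltnSn orbT.
have maxB (a b c : R) : Num.max a b - c = Num.max (a - c) (b - c).
  by rewrite addr_maxl.
split=> [j jk|j kj||[q1 q2] /= iq].
- rewrite /burke_flip /= !xpair_eqE /= eqSS.
  case: eqVneq => [->|jnk].
    rewrite yk yi IH3 xb// -[RHS]addrA maxB subrr; congr (_ + Num.max _ _).
    by ring.
  by apply: IH1; rewrite ltn_neqAle jnk -ltnS.
- rewrite /burke_flip /= !xpair_eqE /= eqSS.
  by rewrite gtn_eqF//= IH2// ltnW.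
- rewrite /burke_flip /= eqxx yi yk IH3 xb// -[RHS]addrA maxB subrr maxC.
  congr (_ + Num.max _ _).
  by ring.
- rewrite /burke_flip /= !xpair_eqE /= => qk.
  have q10 : (q1 == 0%N) = false by apply/negbTE; rewrite -lt0n; case: q1 iq {qk}.
  rewrite q10 /=; case/orP: qk => [iq'|kq].
    by rewrite gtn_eqF//= IH4//= iq'.
  rewrite [q2 == 0%N]gtn_eqF ?(leq_trans _ kq)// [q2 == k.+1]gtn_eqF// !andbF.
  by rewrite IH4//= (ltnW kq) orbT.
Qed.

Lemma sweepE x n i :
  (forall j, (j < n)%N -> sweep n i x (0%N, j.+1) = lpp x i j.+1 - lpp x i j) /\
  (forall q, (i < q.1)%N -> sweep n i x q = x q).
Proof.
elim: i => [|i [IH1 IH2]].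
  by split=> // j _; rewrite lpp0S addrAC subrr add0r.
have [] := @sweep_columnE (sweep n i x) i n (lpp x i) (lpp x i.+1) n (leqnn n) IH1.
- by rewrite IH2//= addrAC subrr add0r.
- by move=> j jn; rewrite IH2.
move=> h1 _ _ h4; split => // q iq.
by rewrite /= h4 ?iq ?IH2// ltnW.
Qed.

End last_passage_increments.
Arguments lpp : simpl never.

(** * The exact moment generating function *)

Section moment_generating_function.
Local Open Scope ereal_scope.
Context d (Omega : measurableType d) (R : realType).
Local Notation RM := (measurableTypeR R).
Local Notation expo := (@exponential_law R).
Implicit Types (P : {measure set Omega -> \bar R}) (X : Omega -> nat * nat -> R).

Definition boundary_law (w z : R) (q : nat * nat) : probability RM R :=
  match q with
  | (0%N, 0%N) => expo 0
  | (_.+1, 0%N) => expo w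
  | (0%N, _.+1) => expo (1 - z)%R
  | (_.+1, _.+1) => expo 1
  end.

Lemma measurable_expR_linear (s : R) :
  measurable_fun [set: RM] (fun x : R => expR (s * x) : R)%R.
Proof.
have msx : measurable_fun [set: RM] (fun x : R => s * x : R)%R.
  exact: measurable_funM.
exact: (measurableT_comp (@measurable_expR R) msx).
Qed.

Lemma exponential_law_mgf (r s : R) : (0 < r)%R -> (s < r)%R ->
  \int[expo r]_x (expR (s * x))%:E = (r / (r - s))%:E.
Proof.
move=> r0 sr.
transitivity (\int[expo r]_x ((expR (s * x))%:E * 1)).
  by apply: eq_integral => x _; rewrite mule1.
rewrite integral_exponential_law_tilt// integral_cst//.
rewrite (_ : _ setT = 1); last exact: probability_setT.
by rewrite !mule1.
Qed.

Lemma independent_sweep P X (mu : nat * nat -> probability RM R) (z : R) (m n : nat) :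
  (0 < z)%R -> (z < 1)%R ->
  (forall i, (i < m)%N -> mu (i.+1, 0%N) = expo z) ->
  (forall j, mu (0%N, j.+1) = expo (1 - z)%R) ->
  (forall i j, mu (i.+1, j.+1) = expo 1) ->
  independent_with_laws P mu X ->
  independent_with_laws P mu (fun t => sweep n m (X t)).
Proof.
move=> z0 z1 + muv mub iX; elim: m => [//|m IH] muh /=.
have {}IH := IH (fun i im => muh i (leqW im)).
elim: {1}n => [|k IHk] /=; first exact: IH.
apply: (@independent_burke_flip _ _ _ _ P
  (fun t => sweep_column m k (sweep n m (X t))) mu (m.+1, 0%N) (0%N, k.+1)
  (m.+1, k.+1) z (1 - z)%R) => //.
- by rewrite subr_gt0.
- by rewrite /= !inE !xpair_eqE /= andbF.
- exact: muh.
- by rewrite mub addrC subrK.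
Qed.

(** The bottom weights are tilted from rate w to rate z, with normalizing factor
    z / w each; the sum of these weights is the last-passage time to (m, 0). Under
    the tilted measure the sweep preserves all laws, and after m columns the slots
    (0, j + 1) hold the increments from (m, 0) up to (m, n). *)
Lemma lpp_mgf P X (w z : R) (m n : nat) :
  (0 < z)%R -> (z < 1)%R -> (0 < w)%R -> (w < 1)%R ->
  independent_with_laws P (boundary_law w z) X ->
  \int[P]_t (expR ((w - z) * lpp (X t) m n))%:E =
  ((w / z) ^+ m * ((1 - z) / (1 - w)) ^+ n)%:E.
Proof.
move=> z0 z1 w0 w1 iX; have mX := iX.1; set th := (w - z)%R.
have w_th : (w - th = z)%R by rewrite /th opprB addrC subrK.
pose s0 := [seq (i.+1, 0%N) | i <- iota 0 m].
have us0 : uniq s0 by rewrite map_inj_uniq ?iota_uniq// => i j [].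
have s0E i j : ((i, j) \in s0) = [&& (0 < i)%N, (i <= m)%N & j == 0%N].
  apply/mapP/and3P => [[k]|[i0 im /eqP->]].
    by rewrite mem_iota add0n => /andP[_ km] [-> ->].
  by exists i.-1; rewrite ?mem_iota ?add0n prednK.
pose g q (x : RM) : R := if q \in s0 then (z / w * expR (th * x))%R else 1%R.
pose nu q := if q \in s0 then expo z else boundary_law w z q.
have mg q : measurable_fun setT (g q).
  rewrite /g; case: (q \in s0); last exact: measurable_cst.
  by apply: measurable_funM => //; exact: measurable_expR_linear.
have g0 q x : (0 <= g q x)%R.
  by rewrite /g; case: (q \in s0) => //; rewrite mulr_ge0 ?expR_ge0// divr_ge0// ltW.
pose D t := (\prod_(q <- s0) g q (X t q))%R.
have mD : measurable_fun setT D.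
  by apply: measurable_prod => q _; exact: (measurableT_comp (mg q) (mX q)).
have D0 t : (0 <= D t)%R by rewrite prodr_ge0.
have gnu q B : measurable B -> \int[boundary_law w z q]_x (g q x * \1_B x)%:E = nu q B.
  move=> mB; rewrite /g /nu.
  have mI : measurable_fun setT (fun x => (\1_B x)%:E : \bar R).
    by apply/measurable_EFinP; exact: measurable_indic.
  case: (boolP (q \in s0)) => [|_]; last first.
    by under eq_integral do rewrite mul1r; rewrite integral_indic// setIT.
  case: q => -[|i] [|j]; rewrite s0E/= ?andbF// => _.
  transitivity (\int[expo w]_x ((z / w)%:E * ((expR (th * x))%:E * (\1_B x)%:E))).
    by apply: eq_integral => x _; rewrite -!EFinM mulrA.
  rewrite ge0_integralZl_EFin//; last 2 first.
  - by apply: emeasurable_funM => //; apply/measurable_EFinP; exact: measurable_expR_linear.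
  - by rewrite divr_ge0// ltW.
  rewrite integral_exponential_law_tilt//; last by rewrite /th gtrBl.
  rewrite w_th integral_indic// setIT muleA -EFinM mulrA divfK ?gt_eqF// divff ?gt_eqF//.
  by rewrite mul1e.
pose Q := density_measure P mD D0.
have iQ : independent_with_laws Q nu X.
  by apply: (independent_tilt mD D0 iX us0 mg g0 _ gnu) => q /negbTE qs x; rewrite /g qs.
have {}iQ : independent_with_laws Q nu (fun t => sweep n m (X t)).
  apply: (@independent_sweep _ _ _ z) => //.
  - by move=> i im; rewrite /nu s0E im.
  - by move=> j; rewrite /nu s0E.
  - by move=> i j; rewrite /nu s0E andbF.
pose s1 := [seq (0%N, j.+1) | j <- iota 0 n].
have us1 : uniq s1 by rewrite map_inj_uniq ?iota_uniq// => i j [].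
have s1E i j : ((i, j) \in s1) = [&& i == 0%N, (0 < j)%N & (j <= n)%N].
  apply/mapP/and3P => [[k]|[/eqP -> i0 im]].
    by rewrite mem_iota add0n => /andP[_ km] [-> ->].
  by exists j.-1; rewrite ?mem_iota ?add0n prednK.
pose h q (x : RM) : R := if q \in s1 then expR (th * x)%R else 1%R.
have mh q : measurable_fun setT (h q).
  rewrite /h; case: (q \in s1); last exact: measurable_cst.
  exact: measurable_expR_linear.
have h0 q x : (0 <= h q x)%R by rewrite /h; case: (q \in s1) => //; rewrite expR_ge0.
pose c q := (if q \in s1 then (1 - z) / (1 - w) else 1)%R.
have hc q : \int[nu q]_x (h q x)%:E = (c q)%:E.
  rewrite /h /c; case: (boolP (q \in s1)) => [|_]; last first.
    by rewrite integral_cst// mul1e; exact: probability_setT.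
  case: q => -[|i] [|j]; rewrite s1E//= => _.
  rewrite /nu s0E/= exponential_law_mgf ?subr_gt0 ?ltrD2r//.
  by congr (_ / _)%:E; rewrite /th; ring.
have hE t : (\prod_(q <- s1) h q (sweep n m (X t) q) =
    expR (th * (lpp (X t) m n - lpp (X t) m 0)))%R.
  have [sE _] := sweepE (X t) n m.
  transitivity (\prod_(q <- s1) expR (th * sweep n m (X t) q))%R.
    by apply: eq_big_seq => q qs; rewrite /h qs.
  rewrite big_map -/(index_iota 0 n) -[n in iota 0 n]subn0 -/(index_iota 0 n).
  rewrite big_mkord -expR_sum -mulr_sumr; congr (expR (_ * _))%R.
  transitivity (\sum_(j < n) (lpp (X t) m j.+1 - lpp (X t) m j))%R.
    by apply: eq_bigr => j _; exact: sE.
  by rewrite -(big_mkord xpredT (fun j => lpp (X t) m j.+1 - lpp (X t) m j)%R) telescope_sumr.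
have DE t : (expR (th * lpp (X t) m 0) = (w / z) ^+ m * D t)%R.
  rewrite lpp_row0 mulr_sumr expR_sum /D.
  transitivity (\prod_(q <- s0) (w / z * g q (X t q)))%R.
    rewrite big_map -[m in iota 0 m]subn0 -/(index_iota 0 m) big_mkord.
    apply: eq_bigr => i _; rewrite /g s0E /= ltn_ord mulrA.
    by rewrite mulrA divfK ?gt_eqF// divff ?gt_eqF// mul1r.
  by rewrite big_split/= big_const_seq count_predT size_map size_iota iter_mulr_1.
have lppE t : (expR (th * lpp (X t) m n) =
    (w / z) ^+ m * (D t * \prod_(q <- s1) h q (sweep n m (X t) q)))%R.
  by rewrite hE mulrA -DE -expRD; congr expR; ring.
have mprod : measurable_fun setT
    (fun t => \prod_(q <- s1) h q (sweep n m (X t) q))%R.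
  by apply: measurable_prod => q _; exact: (measurableT_comp (mh q) (iQ.1 q)).
have prod0 t : (0 <= \prod_(q <- s1) h q (sweep n m (X t) q))%R by rewrite prodr_ge0.
under eq_integral do rewrite lppE EFinM.
rewrite ge0_integralZl_EFin//; last 3 first.
- by move=> t _; rewrite lee_fin mulr_ge0.
- by apply/measurable_EFinP; exact: measurable_funM.
- by rewrite exprn_ge0// divr_ge0// ltW.
rewrite EFinM; congr (_ * _).
transitivity (\int[Q]_t (\prod_(q <- s1) h q (sweep n m (X t) q))%:E).
  rewrite ge0_integral_density//.
    by apply: eq_integral => t _; rewrite -EFinM mulrC.
  exact/measurable_EFinP.
rewrite (expectation_prod iQ mh h0 hc us1); congr EFin.
transitivity (\prod_(q <- s1) ((1 - z) / (1 - w)))%R.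
  by apply: eq_big_seq => q qs; rewrite /c qs.
by rewrite big_const_seq count_predT size_map size_iota iter_mulr_1.
Qed.

End moment_generating_function.

(** * Up-right paths *)

Section paths.
Context {R : realType}.
Implicit Types (x y : nat * nat -> R) (u v q : nat * nat) (s : seq (nat * nat)).

Lemma up_right_step_hor i j : up_right_step (i, j) (i.+1, j).
Proof. by apply/orP; left; apply/eqP. Qed.

Lemma up_right_step_ver i j : up_right_step (i, j) (i, j.+1).
Proof. by apply/orP; right; apply/eqP. Qed.

Lemma up_right_paths_rcons u v v' s : up_right_paths u v s ->
  up_right_step v v' -> up_right_paths u v' (rcons s v').
Proof.
move=> [t [-> pt lt]] vv'; exists (rcons t v').
by rewrite last_rcons rcons_path pt lt vv'.
Qed.

Lemma up_right_paths_within u v s q : up_right_paths u v s -> q \in s ->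
  [&& (u.1 <= q.1)%N, (q.1 <= v.1)%N, (u.2 <= q.2)%N & (q.2 <= v.2)%N].
Proof.
move=> [t [-> pt <-]] {s v}; elim: t u q pt => [|a t IH] u q /=.
  by move=> _; rewrite inE => /eqP ->; rewrite !leqnn.
case/andP=> ua pt.
have /andP[u1 u2] : (u.1 <= a.1)%N && (u.2 <= a.2)%N.
  by case/orP: ua => /eqP ->/=; rewrite !leqnn !leqnSn.
rewrite inE => /orP[/eqP ->|/(IH _ _ pt)].
  have /and4P[_ a1 _ a2] := IH a a pt (mem_head _ _).
  by rewrite !leqnn (leq_trans u1 a1) (leq_trans u2 a2).
by case/and4P => h1 h2 h3 h4; rewrite h2 h4 (leq_trans u1 h1) (leq_trans u2 h3).
Qed.

Lemma up_right_paths_uniq u v s : up_right_paths u v s -> uniq s.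
Proof.
move=> [t [-> pt _]]; apply: (@map_uniq _ _ (fun q => q.1 + q.2)%N).
apply: (sorted_uniq ltn_trans ltnn); apply: (homo_path _ pt) => p q.
by case/orP => /eqP -> /=; rewrite ?addSn ?addnS.
Qed.

Lemma up_right_paths_size u v s : up_right_paths u v s ->
  (v.1 + v.2 + 1 = u.1 + u.2 + size s)%N.
Proof.
by move=> [t [-> pt <-]]; rewrite size_up_right//= addn1 addnS.
Qed.

Lemma up_right_paths_exist u v : (u.1 <= v.1)%N -> (u.2 <= v.2)%N ->
  up_right_paths u v !=set0.
Proof.
case: u v => [i j] [k l] /=.
elim: k => [|k IH].
  rewrite leqn0 => /eqP ->; elim: l => [|l IHl].
    by rewrite leqn0 => /eqP ->; exists [:: (0%N, 0%N)], [::].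
  rewrite leq_eqVlt => /orP[/eqP ->|/IHl[s us]]; first by exists [:: (0%N, l.+1)], [::].
  exists (rcons s (0%N, l.+1)).
  exact: up_right_paths_rcons us (up_right_step_ver _ _).
rewrite leq_eqVlt => /orP[/eqP ->|ik jl]; last first.
  have [s us] := IH ik jl; exists (rcons s (k.+1, l)).
  exact: up_right_paths_rcons us (up_right_step_hor _ _).
elim: l {IH} => [|l IHl].
  by rewrite leqn0 => /eqP ->; exists [:: (k.+1, 0%N)], [::].
rewrite leq_eqVlt => /orP[/eqP ->|/IHl[s us]]; first by exists [:: (k.+1, l.+1)], [::].
exists (rcons s (k.+1, l.+1)).
exact: up_right_paths_rcons us (up_right_step_ver _ _).
Qed.

Lemma le_last_passage x y u v : (u.1 <= v.1)%N -> (u.2 <= v.2)%N ->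
  (forall q, [&& u.1 <= q.1, q.1 <= v.1, u.2 <= q.2 & q.2 <= v.2]%N ->
    x q <= y q) ->
  last_passage x u v <= last_passage y u v.
Proof.
move=> uv1 uv2 xy; have uv := up_right_paths_exist uv1 uv2.
have [[s us ->] _] := last_passage_max x uv.
have [_ ymax] := last_passage_max y uv.
apply: le_trans (ymax _ us); rewrite big_seq [leRHS]big_seq; apply: ler_sum => q qs.
by apply: xy; exact: up_right_paths_within us qs.
Qed.

Lemma lpp_step x u v : up_right_step u v ->
  lpp x u.1 u.2 + x v <= lpp x v.1 v.2.
Proof.
case: u => i j /orP[] /eqP -> /=.
  case: j => [|j]; first by rewrite lppS0.
  by rewrite addrC lppSS lerD2l le_max lexx.
case: i => [|i]; first by rewrite lpp0S.
by rewrite addrC lppSS lerD2l le_max lexx orbT.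
Qed.

(** The condition says that u is reached from the origin with its own weight only, as
    is the case for (1, 0) and (0, 1). *)
Lemma path_sum_le_lpp x u v s : up_right_paths u v s -> lpp x u.1 u.2 = x u ->
  \sum_(q <- s) x q <= lpp x v.1 v.2.
Proof.
move=> [t [-> pt <-]] xu; rewrite big_cons -xu {s v xu}.
elim: t u pt => [|a t IH] u /=; first by rewrite big_nil addr0.
case/andP => ua /IH; apply: le_trans.
by rewrite big_cons addrA lerD2r lpp_step.
Qed.

Lemma lpp_attained x i j : (0 < i + j)%N -> exists s,
  (up_right_paths (1%N, 0%N) (i, j) s \/ up_right_paths (0%N, 1%N) (i, j) s) /\
  \sum_(q <- s) x q = lpp x i j.
Proof.
have step u v : up_right_step u v -> lpp x v.1 v.2 = lpp x u.1 u.2 + x v ->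
    (exists s, (up_right_paths (1%N, 0%N) u s \/ up_right_paths (0%N, 1%N) u s) /\
      \sum_(q <- s) x q = lpp x u.1 u.2) ->
    exists s, (up_right_paths (1%N, 0%N) v s \/ up_right_paths (0%N, 1%N) v s) /\
      \sum_(q <- s) x q = lpp x v.1 v.2.
  move=> uv vE [s [us sE]]; exists (rcons s v); split.
    by case: us => us; [left|right]; apply: up_right_paths_rcons us uv.
  by rewrite big_rcons/= sE vE addrC.
elim: i j => [|i IHi] j; last elim: j => [|j IHj] _.
- elim: j => [//|[|j] IHj] _.
    exists [:: (0%N, 1%N)]; split; first by right; exists [::].
    by rewrite big_seq1 lpp0S lpp00 add0r.
  apply: (step (0%N, j.+1) (0%N, j.+2)); [|exact: lpp0S|exact: IHj].
  exact: up_right_step_ver.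
- case: i IHi => [|i] IHi.
    exists [:: (1%N, 0%N)]; split; first by left; exists [::].
    by rewrite big_seq1 lppS0 lpp00 add0r.
  apply: (step (i.+1, 0%N) (i.+2, 0%N)); [|exact: lppS0|exact: IHi].
  exact: up_right_step_hor.
- have [le|le] := leP (lpp x i j.+1) (lpp x i.+1 j).
    apply: (step (i.+1, j) (i.+1, j.+1)); [| |exact: IHj].
      exact: up_right_step_ver.
    by rewrite lppSS max_r// addrC.
  apply: (step (i, j.+1) (i.+1, j.+1)); [| |apply: IHi; rewrite addnS//].
    exact: up_right_step_hor.
  by rewrite lppSS max_l ?ltW// addrC.
Qed.

(** A path from the origin makes its first step to (1, 0) or to (0, 1). *)
Lemma lppE_max x v : (0 < v.1)%N -> (0 < v.2)%N ->
  lpp x v.1 v.2 =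
  Num.max (last_passage x (1%N, 0%N) v) (last_passage x (0%N, 1%N) v).
Proof.
move=> v1 v2.
have hor_path := @up_right_paths_exist (1%N, 0%N) v v1 (leq0n _).
have ver_path := @up_right_paths_exist (0%N, 1%N) v (leq0n _) v2.
have [[s1 us1 s1E] max1] := last_passage_max x hor_path.
have [[s2 us2 s2E] max2] := last_passage_max x ver_path.
apply/eqP; rewrite eq_le; apply/andP; split.
  have [s [us <-]] := lpp_attained x (ltn_addr v.2 v1).
  rewrite -surjective_pairing in us.
  by case: us => us; rewrite le_max ?(max1 _ us)// (max2 _ us) orbT.
rewrite ge_max s1E s2E (path_sum_le_lpp us1) ?(path_sum_le_lpp us2)//.
  by rewrite lpp0S lpp00 add0r.
by rewrite lppS0 lpp00 add0r.
Qed.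

End paths.

Section measurable_last_passage.
Context d (Omega : measurableType d) (R : realType).

Lemma measurable_last_passage (X : Omega -> nat * nat -> R) u v :
  (forall q, measurable_fun setT (fun t => X t q)) ->
  (u.1 <= v.1)%N -> (u.2 <= v.2)%N ->
  measurable_fun setT (fun t => last_passage (X t) u v).
Proof.
move=> mX uv1 uv2; have uv := up_right_paths_exist uv1 uv2.
have [s0 us0] := uv.
pose l := [seq s <- path_enum ((v.1 + v.2) - (u.1 + u.2)) u | `[< up_right_paths u v s >]].
have lP s : s \in l <-> up_right_paths u v s.
  split=> [|us]; first by rewrite mem_filter => /andP[/asboolP].
  rewrite mem_filter; apply/andP; split; first exact/asboolP.
  by case: us => t [-> pt <-]; rewrite size_up_right// addKn; exact: path_enumP.
pose F s t : R := \sum_(q <- s) X t q.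
have -> : (fun t => last_passage (X t) u v) =
    (fun t => \big[Num.max/F s0 t]_(s <- l) F s t).
  apply/funext => t; have [[s us sE] smax] := last_passage_max (X t) uv.
  apply/eqP; rewrite eq_le; apply/andP; split.
    by rewrite sE; apply: le_bigmax_seq => //; exact/lP.
  rewrite big_seq; apply: bigmax_le => [|s' /lP us']; exact: smax.
have msum s : measurable_fun setT (F s).
  by apply: measurable_sum.
elim: l {lP} => [|s l IH]; first by under eq_fun do rewrite big_nil; exact: msum.
by under eq_fun do rewrite big_cons; exact: measurable_maxr.
Qed.

End measurable_last_passage.

(** * Expansion at the characteristic parameter *)

Section log_moment_bounds.
Context {R : realType}.
Implicit Types (x u r : R).

Let taylor3 (y : R) : R := (y - 1) - 2^-1 * (y - 1) ^+ 2 + 3^-1 * (y - 1) ^+ 3.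

Let is_derive_ln_taylor3 x : 0 < x ->
  is_derive x 1 (fun y : R => ln y - taylor3 y) (- ((x - 1) ^+ 3 / x)).
Proof.
move=> x0; have dln := is_derive1_ln x0.
pose u : R -> R := id - cst 1.
have du : is_derive x 1 u 1 by apply: is_derive_eq; rewrite subr0.
have dF := is_deriveB dln (is_deriveD (is_deriveB du
  (is_deriveZ 2^-1 (is_deriveX 2 du))) (is_deriveZ 3^-1 (is_deriveX 3 du))).
apply: (is_derive_eq dF).
rewrite /u /GRing.scale /= expr1 !mulr1.
rewrite (_ : (id - cst 1) x = x - 1)//.
field.
by rewrite gt_eqF.
Qed.

Let continuous_ln_taylor3 x : 0 < x -> {for x, continuous (fun y : R => ln y - taylor3 y)}.
Proof.
move=> x0; apply/differentiable_continuous/derivable1_diffP.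
by have [] := is_derive_ln_taylor3 x0.
Qed.

(** The derivative of the error is - (y - 1)^3 / y, so that the mean value theorem
    bounds the error by (40 / 39) |x|^4. The constant 30 makes the cubic coefficient
    1 / 3 of the logarithm lie between 3 / 10 and 11 / 30 in the applications. *)
Lemma ln_taylor3 x : `|x| <= 40^-1 ->
  `|ln (1 + x) - (x - 2^-1 * x ^+ 2 + 3^-1 * x ^+ 3)| <= `|x| ^+ 3 / 30.
Proof.
move=> x40; have [xl xu] : - 40^-1 <= x /\ x <= 40^-1 by apply/andP; rewrite -ler_norml.
set F := fun y : R => ln y - taylor3 y.
have F1 : F 1 = 0.
  by rewrite /F /taylor3 ln1 !subrr !expr0n /= !mulr0; ring.
suff [c [c0 cx Fc]] : exists c : R, [/\ 39 / 40 <= c, `|c - 1| <= `|x| &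
    F (1 + x) = - ((c - 1) ^+ 3 / c) * x].
  have -> : ln (1 + x) - (x - 2^-1 * x ^+ 2 + 3^-1 * x ^+ 3) = F (1 + x).
    by rewrite /F /taylor3 [1 + x]addrC addrK.
  rewrite Fc normrM normrN normrM normfV normrX.
  have cpos : 0 < c by lra.
  rewrite (gtr0_norm cpos) mulrAC ler_pdivrMr//.
  have le3 : `|c - 1| ^+ 3 <= `|x| ^+ 3 by rewrite lerXn2r ?nnegrE.
  apply: (@le_trans _ _ (`|x| ^+ 3 * 40^-1)).
    by apply: ler_pM => //; rewrite exprn_ge0.
  by rewrite -[leRHS]mulrA ler_wpM2l ?exprn_ge0//; lra.
have [x0|x0] := leP 0 x.
  have [|||c cI Fc] := @MVT_segment _ F (fun y => - ((y - 1) ^+ 3 / y)) 1 (1 + x).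
  - by rewrite lerDl.
  - by move=> y; rewrite in_itv/= => /andP[y1 _]; apply: is_derive_ln_taylor3; lra.
  - apply: continuous_in_subspaceT => y; rewrite inE/= in_itv/= => /andP[y1 _].
    by apply: continuous_ln_taylor3; lra.
  exists c; move: cI; rewrite in_itv/= => /andP[c1 c2]; split; first by lra.
    by rewrite !ger0_norm; lra.
  by move: Fc; rewrite F1 subr0 => ->; rewrite [1 + x]addrC addrK.
have [|||c cI Fc] := @MVT_segment _ F (fun y => - ((y - 1) ^+ 3 / y)) (1 + x) 1.
- by rewrite gerDl ltW.
- move=> y; rewrite in_itv/= => /andP[y1 _]; apply: is_derive_ln_taylor3.
  by lra.
- apply: continuous_in_subspaceT => y; rewrite inE/= in_itv/= => /andP[y1 _].
  by apply: continuous_ln_taylor3; lra.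
exists c; move: cI; rewrite in_itv/= => /andP[c1 c2]; split; first by lra.
  by rewrite !ler0_norm; lra.
move: Fc; rewrite F1 sub0r => /eqP; rewrite eqr_oppLR => /eqP ->.
by rewrite opprD addrA subrr sub0r mulrN opprK.
Qed.

(** The logarithm of the moment generating function at v, divided by gamma, is
    [log_mgf_rate r (w - r) - log_mgf_rate r (z - r)] for r the value of zeta: see
    [lpp_mgf_valueE]. *)
Definition log_mgf_rate r u : R :=
  r ^+ 2 * ln (1 + u / r) - (1 - r) ^+ 2 * ln (1 - u / (1 - r)).

(** The quadratic terms cancel: both are u^2 / 2, since the prefactor r^2 compensates
    (u / r)^2 and (1 - r)^2 compensates (u / (1 - r))^2. The cubic terms add up, since
    1 / r + 1 / (1 - r) = 1 / (r (1 - r)). *)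
Lemma log_mgf_rate_taylor r u : 0 < r -> r < 1 ->
  `|u| <= r / 40 -> `|u| <= (1 - r) / 40 ->
  `|log_mgf_rate r u - (u + (r * (1 - r))^-1 * u ^+ 3 / 3)| <=
  (r * (1 - r))^-1 * `|u| ^+ 3 / 30.
Proof.
move=> r0 r1 ur us; have s0 : 0 < 1 - r by rewrite subr_gt0.
have rn0 : r != 0 by rewrite gt_eqF.
have sn0 : 1 - r != 0 by rewrite gt_eqF.
have h1 : `|u / r| <= 40^-1.
  by rewrite normrM normfV (gtr0_norm r0) ler_pdivrMr// mulrC.
have h2 : `|- (u / (1 - r))| <= 40^-1.
  by rewrite normrN normrM normfV (gtr0_norm s0) ler_pdivrMr// mulrC.
have t1 := ln_taylor3 h1; have t2 := ln_taylor3 h2.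
set A := ln _ - _ in t1; set B := ln _ - _ in t2.
have -> : log_mgf_rate r u - (u + (r * (1 - r))^-1 * u ^+ 3 / 3) =
    r ^+ 2 * A - (1 - r) ^+ 2 * B.
  by rewrite /log_mgf_rate /A /B; field; rewrite rn0 sn0.
apply: le_trans (ler_normB _ _) _.
rewrite (normrM (r ^+ 2) A) (normrM ((1 - r) ^+ 2) B).
rewrite (ger0_norm (sqr_ge0 r)) (ger0_norm (sqr_ge0 (1 - r))).
apply: le_trans (lerD (ler_wpM2l (sqr_ge0 r) t1) (ler_wpM2l (sqr_ge0 (1 - r)) t2)) _.
rewrite normrN !normrM !normfV (gtr0_norm r0) (gtr0_norm s0).
by rewrite le_eqVlt; apply/orP; left; apply/eqP; field; rewrite rn0 sn0.
Qed.

Definition lpp_mgf_value (w z : R) (v : nat * nat) : R :=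
  (w / z) ^+ v.1 * ((1 - z) / (1 - w)) ^+ v.2.

Section shape_parameters.
Variable v : nat * nat.
Hypotheses (v10 : (0 < v.1)%N) (v20 : (0 < v.2)%N).
Local Notation G := (gamma (@vec R v)).
Local Notation r := (zeta (@vec R v)).

Lemma gamma_zeta : [/\ 0 < r, r < 1, 0 < G, v.1%:R = G * r ^+ 2 &
  v.2%:R = G * (1 - r) ^+ 2].
Proof.
rewrite /gamma /zeta /=.
have m0 : 0 < (v.1%:R : R) by rewrite ltr0n.
have n0 : 0 < (v.2%:R : R) by rewrite ltr0n.
have sm : 0 < Num.sqrt (v.1%:R : R) by rewrite sqrtr_gt0.
have sn : 0 < Num.sqrt (v.2%:R : R) by rewrite sqrtr_gt0.
have mE := esym (sqr_sqrtr (ltW m0)); have nE := esym (sqr_sqrtr (ltW n0)).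
move: sm sn mE nE; set a := Num.sqrt (v.1%:R : R); set b := Num.sqrt (v.2%:R : R).
move=> sm sn mE nE; have ab : 0 < a + b by rewrite addr_gt0.
have abn : a + b != 0 by rewrite gt_eqF.
split.
- by rewrite divr_gt0.
- by rewrite ltr_pdivrMr// mul1r ltrDl.
- by rewrite exprn_gt0.
- by rewrite mE; field.
- by rewrite nE; field.
Qed.

Lemma lpp_mgf_valueE (w z : R) : 0 < w -> w < 1 -> 0 < z -> z < 1 ->
  lpp_mgf_value w z v = expR (G * (log_mgf_rate r (w - r) - log_mgf_rate r (z - r))).
Proof.
move=> w0 w1 z0 z1; have [r0 r1 G0 mE nE] := gamma_zeta.
have w1' : 0 < 1 - w by rewrite subr_gt0.
have z1' : 0 < 1 - z by rewrite subr_gt0.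
have r1' : 0 < 1 - r by rewrite subr_gt0.
have ln1 u : 0 < u -> ln (1 + (u - r) / r) = ln u - ln r.
  move=> u0; rewrite -ln_div ?posrE//; congr ln.
  by rewrite mulrBl divff ?gt_eqF// addrC subrK.
have ln2 u : 0 < 1 - u -> ln (1 - (u - r) / (1 - r)) = ln (1 - u) - ln (1 - r).
  move=> u0; rewrite -ln_div ?posrE//; congr ln.
  by field; rewrite gt_eqF.
rewrite /log_mgf_rate !ln1// !ln2//.
have -> : G * (r ^+ 2 * (ln w - ln r) - (1 - r) ^+ 2 * (ln (1 - w) - ln (1 - r)) -
      (r ^+ 2 * (ln z - ln r) - (1 - r) ^+ 2 * (ln (1 - z) - ln (1 - r)))) =
    v.1%:R * (ln w - ln z) + v.2%:R * (ln (1 - z) - ln (1 - w)).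
  by rewrite mE nE; ring.
by rewrite expRD !expRM_natl -!ln_div ?posrE// !lnK ?posrE ?divr_gt0.
Qed.

Lemma lpp_mgf_value_bounds (a b : R) : 0 <= a -> 0 <= b ->
  a <= r / 40 -> a <= (1 - r) / 40 -> b <= r / 40 -> b <= (1 - r) / 40 ->
  expR (G * (a + b) + (r * (1 - r))^-1 * G * (a ^+ 3 + b ^+ 3) * (3 / 10)) <=
    lpp_mgf_value (r + a) (r - b) v <=
  expR (G * (a + b) + (r * (1 - r))^-1 * G * (a ^+ 3 + b ^+ 3) * (11 / 30)).
Proof.
move=> a0 b0 ar as_ br bs; have [r0 r1 G0 _ _] := gamma_zeta.
have r1' : 0 < 1 - r by rewrite subr_gt0.
rewrite lpp_mgf_valueE; [|lra..].
rewrite !ler_expR [r + a]addrC addrK [r - b]addrC addrK.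
have ta : `|a| <= r / 40 by rewrite ger0_norm.
have ta' : `|a| <= (1 - r) / 40 by rewrite ger0_norm.
have tb : `|- b| <= r / 40 by rewrite normrN ger0_norm.
have tb' : `|- b| <= (1 - r) / 40 by rewrite normrN ger0_norm.
have := log_mgf_rate_taylor r0 r1 ta ta'; have := log_mgf_rate_taylor r0 r1 tb tb'.
rewrite normrN !(ger0_norm a0) !(ger0_norm b0) !ler_norml.
set q := (r * (1 - r))^-1; set A := log_mgf_rate r a; set B := log_mgf_rate r (- b).
move=> /andP[b1 b2] /andP[a1 a2].
have -> : forall c, G * (a + b) + q * G * (a ^+ 3 + b ^+ 3) * c =
  G * (a + b + q * (a ^+ 3 + b ^+ 3) * c) by move=> c; ring.
have -> : forall c, G * (a + b) + q * G * (a ^+ 3 + b ^+ 3) * c =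
  G * (a + b + q * (a ^+ 3 + b ^+ 3) * c) by move=> c; ring.
rewrite !ler_pM2l//.
have E : (- b) ^+ 3 = - b ^+ 3 by ring.
rewrite E in b1 b2.
by apply/andP; split; lra.
Qed.

End shape_parameters.
End log_moment_bounds.

(** * The second moment method *)

Section second_moment_method.
Local Open Scope ereal_scope.
Context d (Omega : measurableType d) (R : realType) (P : probability Omega R).

Lemma measurable_superlevel (f : Omega -> R) (c : R) :
  measurable_fun setT f -> measurable [set t | (c <= f t)%R].
Proof.
move=> mf; have -> : [set t | (c <= f t)%R] = f @^-1` `[c, +oo[.
  by apply/seteqP; split=> t; rewrite /= in_itv/= andbT.
by rewrite -[X in measurable X]setTI; apply: mf => //; exact: measurable_itv.
Qed.

(** Integrate the pointwise inequality X <= a / 2 + (a / (4 b)) X^2 + (b / a) 1_A,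
    where A is the event X >= a / 2: outside A the first term suffices, and on A the
    last two have sum at least X by the inequality of the two means. *)
Lemma paley_zygmund (X : Omega -> R) (a b : R) :
  measurable_fun setT X -> (forall t, (0 <= X t)%R) -> (0 < a)%R -> (0 < b)%R ->
  a%:E <= \int[P]_t (X t)%:E -> \int[P]_t (X t ^+ 2)%:E <= b%:E ->
  (a ^+ 2 / (4 * b))%:E <= P [set t | (a / 2 <= X t)%R].
Proof.
move=> mX X0 a0 b0 aX Xb; set A := [set t | _].
have mA : measurable A by exact: measurable_superlevel.
have fA : P A \is a fin_num by rewrite fin_num_measure.
have mX2 : measurable_fun setT (fun t => (X t ^+ 2)%:E).
  by apply/measurable_EFinP; exact: measurable_funX.
have mIA : measurable_fun setT (fun t => (\1_A t)%:E : \bar R).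
  by apply/measurable_EFinP; exact: measurable_indic.
have c1 : (0 <= a / (4 * b))%R by rewrite divr_ge0 ?mulr_ge0 ?ltW.
have c2 : (0 <= b / a)%R by rewrite divr_ge0 ?ltW.
have X2b : \int[P]_t (X t ^+ 2)%:E \is a fin_num.
  rewrite ge0_fin_numE ?integral_ge0// ?(le_lt_trans Xb) ?ltry// => t _.
  by rewrite lee_fin sqr_ge0.
have key : a%:E <= (a / 2)%:E + ((a / (4 * b))%:E * \int[P]_t (X t ^+ 2)%:E +
    (b / a)%:E * P A).
  apply: (le_trans aX).
  have -> : (a / 2)%:E + ((a / (4 * b))%:E * \int[P]_t (X t ^+ 2)%:E + (b / a)%:E * P A) =
    \int[P]_t ((a / 2)%:E + ((a / (4 * b))%:E * (X t ^+ 2)%:E + (b / a)%:E * (\1_A t)%:E)).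
    rewrite ge0_integralD//; last 3 first.
    - by move=> t _; rewrite lee_fin divr_ge0 ?ltW.
    - by move=> t _; rewrite adde_ge0 ?mule_ge0 ?lee_fin ?sqr_ge0.
    - by apply: emeasurable_funD; exact: measurable_funeM.
    rewrite ge0_integralD//; last 4 first.
    - by move=> t _; rewrite mule_ge0 ?lee_fin ?sqr_ge0.
    - exact: measurable_funeM.
    - by move=> t _; rewrite mule_ge0 ?lee_fin.
    - exact: measurable_funeM.
    rewrite integral_cst// ge0_integralZl_EFin//; last first.
    - by move=> t _; rewrite lee_fin sqr_ge0.
    rewrite ge0_integralZl_EFin// integral_indic// setIT.
    congr (_ + _); rewrite -[LHS]mule1; congr (_ * _).
    exact/esym/probability_setT.
  apply: ge0_le_integral => //.
  - by move=> t _; rewrite lee_fin.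
  - exact/measurable_EFinP.
  - by apply: emeasurable_funD => //; apply: emeasurable_funD; exact: measurable_funeM.
  move=> t _; rewrite -!EFinM -!EFinD lee_fin indicE.
  case: (boolP (t \in A)) => [_|tA].
    rewrite mulr1 -subr_ge0.
    have -> : (a / 2 + (a / (4 * b) * X t ^+ 2 + b / a) - X t =
       a / 2 + a / (4 * b) * (X t - 2 * b / a) ^+ 2)%R.
      by field; rewrite !gt_eqF.
    by apply: addr_ge0; [rewrite divr_ge0 ?ltW|apply: mulr_ge0 => //; exact: sqr_ge0].
  rewrite mulr0 addr0; apply: (@le_trans _ _ (a / 2)%R).
    rewrite leNgt; apply: contra tA => /ltW h; exact/mem_set.
  by rewrite lerDl mulr_ge0// sqr_ge0.
move: key; rewrite -(fineK fA) -(fineK X2b) -!EFinM -!EFinD !lee_fin => key.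
have {}Xb : (fine (\int[P]_t (X t ^+ 2)%:E) <= b)%R by rewrite -lee_fin fineK.
have : (a <= a / 2 + (a / (4 * b) * b + b / a * fine (P A)))%R.
  by apply: (le_trans key); rewrite lerD2l lerD2r ler_wpM2l.
have -> : (a / (4 * b) * b = a / 4)%R by field; rewrite gt_eqF.
move=> h; have h' : (a / 4 <= b / a * fine (P A))%R by lra.
rewrite ler_pdivrMr ?mulr_gt0//.
have -> : (a ^+ 2 = a / 4 * (4 * a))%R by field.
apply: (le_trans (ler_wpM2r _ h')); first by rewrite mulr_ge0// ltW.
by rewrite le_eqVlt; apply/orP; left; apply/eqP; field; rewrite gt_eqF.
Qed.

End second_moment_method.

(** * Coupling different boundary parameters *)

Section rescaling.
Local Open Scope ereal_scope.
Context d (Omega : measurableType d) (R : realType).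
Local Notation RM := (measurableTypeR R).
Implicit Types (P : {measure set Omega -> \bar R}).

Lemma independent_scale (I : eqType) P (X : Omega -> I -> R)
    (mu nu : I -> probability RM R) (c : I -> R) :
  independent_with_laws P mu X ->
  (forall i B, measurable B -> mu i ((fun x => c i * x)%R @^-1` B) = nu i B) ->
  independent_with_laws P nu (fun t i => c i * X t i)%R.
Proof.
move=> [mX iX] munu; split=> [i|s B us mB].
  have mXi : measurable_fun setT (fun t => X t i : R) by exact: mX.
  exact: (measurable_funM (measurable_cst (c i)) mXi).
have mcB i : measurable ((fun x : RM => c i * x)%R @^-1` B i).
  have mc : measurable_fun [set: RM] (fun x : R => c i * x : R)%R.
    exact: measurable_funM.
  by rewrite -[X in measurable X]setTI; exact: (mc measurableT _ (mB i)).
have -> : cylinder (fun t i => c i * X t i)%R s B =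
  cylinder X s (fun i => (fun x : RM => c i * x)%R @^-1` B i).
  by apply/seteqP; split => t h i; exact: h.
rewrite (iX _ _ us mcB); apply: eq_bigr => i _.
exact: (munu i (B i) (mB i)).
Qed.

(** An exponential variable of rate w times w / w' has rate w', so the models with
    all boundary parameters live on one probability space, where their last-passage
    times can be compared pointwise. *)
Definition rescale (w z w' z' : R) (x : nat * nat -> R) (q : nat * nat) : R :=
  ((match q with
    | (_.+1, 0%N) => w / w'
    | (0%N, _.+1) => (1 - z) / (1 - z')
    | _ => 1
    end) * x q)%R.

Lemma independent_rescale P X (w z w' z' : R) :
  (0 < w)%R -> (z < 1)%R -> (0 < w')%R -> (z' < 1)%R ->
  independent_with_laws P (boundary_law w z) X ->
  independent_with_laws P (boundary_law w' z') (fun t => rescale w z w' z' (X t)).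
Proof.
move=> w0 z1 w0' z1' iX; apply: independent_scale iX _ => -[i j] B mB.
have id1 : (fun x : RM => 1 * x)%R @^-1` B = B.
  by apply/seteqP; split=> x; rewrite /= mul1r.
have sc (a b : R) : (0 < a)%R -> (0 < b)%R -> (a / (a / b) = b)%R.
  by move=> a0 b0; rewrite invf_div mulrC divfK ?gt_eqF.
case: i j => [|i] [|j]; rewrite /boundary_law ?id1//.
  by rewrite exponential_law_scale ?divr_gt0 ?subr_gt0// sc ?subr_gt0.
by rewrite exponential_law_scale ?divr_gt0// sc.
Qed.

Lemma exponential_law_ge0 (r : R) : exponential_law r `[0%R, +oo[%classic = 1.
Proof.
rewrite /exponential_law; case: pselect => [r0|_]; last first.
  by rewrite /= diracE mem_set//= in_itv/= lexx.
rewrite /= /exponential_measure /density_measure integral_mkcond.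
rewrite -[RHS](@integral_exponential_pdf R r r0); apply: eq_integral => x _.
rewrite patchE; case: ifPn => // x0; rewrite lt0_exponential_pdf//.
by move: x0; rewrite mem_setE in_itv/= andbT -ltNge.
Qed.

(** The laws give nonnegative weights only almost surely; on the event A obtained
    here, last-passage times of rescaled weights can be compared at each point. *)
Lemma weights_ge0 (P : probability Omega R) X (w z : R) (v : nat * nat) :
  independent_with_laws P (boundary_law w z) X ->
  exists2 A, measurable A /\ P (~` A) = 0 &
    forall t, A t -> forall q, (q.1 <= v.1)%N -> (q.2 <= v.2)%N -> (0 <= X t q)%R.
Proof.
move=> [mX iX].
pose s := undup [seq (i, j) | i <- iota 0 v.1.+1, j <- iota 0 v.2.+1].
pose B (q : nat * nat) : set RM := `[0%R, +oo[%classic.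
have mB q : measurable (B q) by exact: measurable_itv.
have mA : measurable (cylinder X s B) by exact: measurable_cylinder.
exists (cylinder X s B).
  split=> //; rewrite probability_setC// iX ?undup_uniq// big1 ?subee// => q _.
  by case: q => [[|i] [|j]]; exact: exponential_law_ge0.
move=> t At q q1 q2; have := At q; rewrite /B /= in_itv/= andbT; apply.
rewrite mem_undup; apply/allpairsP; exists q; rewrite !mem_iota !add0n !ltnS.
by rewrite q1 q2 -surjective_pairing.
Qed.

End rescaling.

(** * The right tail for small deviations *)

Section small_multiples.
Context {R : realType}.
Implicit Types r k c x : R.

Lemma small_multiple_le x k c : 0 < k -> k <= x / 280 -> 0 <= c <= 7 ->
  0 <= c * k <= x / 40.
Proof.
move=> k0 kx /andP[c0 c7]; apply/andP; split; first by rewrite mulr_ge0// ltW.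
apply: (@le_trans _ _ (7 * k)); first by rewrite ler_pM2r.
lra.
Qed.

Lemma small_multiple_unit r k c : 0 < r -> r < 1 -> 0 < k -> k <= r / 280 ->
  k <= (1 - r) / 280 -> 0 <= c <= 7 ->
  [/\ 0 < r + c * k, r + c * k < 1, 0 < r - c * k & r - c * k < 1].
Proof.
move=> r0 r1 k0 kr kr' c7.
have /andP[c0 cr] := small_multiple_le k0 kr c7.
have /andP[_ cr'] := small_multiple_le k0 kr' c7.
by split; lra.
Qed.

End small_multiples.

Section right_tail.
Local Open Scope ereal_scope.
Context d (Omega : measurableType d) (R : realType) (P : probability Omega R).

Lemma le_measure_mod_null (S S' A : set Omega) :
  measurable S -> measurable S' -> measurable A -> P (~` A) = 0 ->
  (forall t, A t -> S t -> S' t) -> P S <= P S'.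
Proof.
move=> mS mS' mA A0 SS'; have mCA := measurableC mA.
have : P S <= P (S' `|` ~` A).
  apply: le_measure; rewrite ?inE//; first exact: measurableU.
  by move=> t St; have [At|nAt] := pselect (A t); [left; exact: SS'|right].
move/le_trans; apply; apply: (@le_trans _ _ (P S' + P (~` A))).
  exact: (@measureU2 _ _ _ P _ _ mS' mCA).
by rewrite A0 adde0.
Qed.

Lemma measurable_expR_scaled (c : R) (f : Omega -> R) : measurable_fun setT f ->
  measurable_fun setT (fun t => (expR (c * f t))%:E).
Proof.
move=> mf; apply/measurable_EFinP; apply: measurableT_comp => //.
exact: measurable_funM.
Qed.

Lemma integral_expR_last_passage_le X (w z : R) (u v : nat * nat) :
  (0 < z)%R -> (z < 1)%R -> (0 < w)%R -> (w < 1)%R -> (z <= w)%R ->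
  (0 < v.1)%N -> (0 < v.2)%N ->
  u = (1%N, 0%N) \/ u = (0%N, 1%N) ->
  independent_with_laws P (boundary_law w z) X ->
  \int[P]_t (expR ((w - z) * last_passage (X t) u v))%:E <=
  (lpp_mgf_value w z v)%:E.
Proof.
move=> z0 z1 w0 w1 zw v1 v2 uE iX; rewrite -(lpp_mgf v.1 v.2 z0 z1 w0 w1 iX).
have mX q : measurable_fun setT (fun t => X t q : R) by exact: iX.1.
have mL : measurable_fun setT (fun t => last_passage (X t) u v).
  by case: uE => ->; exact: measurable_last_passage.
have mM : measurable_fun setT (fun t => lpp (X t) v.1 v.2).
  under eq_fun do rewrite lppE_max//.
  by apply: measurable_maxr; exact: measurable_last_passage.
apply: ge0_le_integral => //.
- exact: measurable_expR_scaled.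
- exact: measurable_expR_scaled.
- move=> t _; rewrite lee_fin ler_expR ler_wpM2l ?subr_ge0// lppE_max//.
  by case: uE => ->; rewrite le_max lexx ?orbT.
Qed.

(** All parameters below differ from zeta by at most 7 k, and the expansion holds up
    to distance min(zeta, 1 - zeta) / 40; hence the bounds on k by 1 / 280. *)
Section near_characteristic.
Variables (X : Omega -> nat * nat -> R) (w z k : R) (v : nat * nat).
Local Notation r := (zeta (@vec R v)).
Local Notation G := (gamma (@vec R v)).
Let y : R := ((r * (1 - r))^-1 * G * k ^+ 3)%R.
Hypotheses (w0 : (0 < w)%R) (z1 : (z < 1)%R)
  (iX : independent_with_laws P (boundary_law w z) X)
  (v1 : (0 < v.1)%N) (v2 : (0 < v.2)%N)
  (k0 : (0 < k)%R) (kr : (k <= r / 280)%R) (kr' : (k <= (1 - r) / 280)%R)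
  (y1 : (1 <= y)%R).

Let Y (w' z' : R) t := rescale w z w' z' (X t).
Let hor (w' z' : R) t := last_passage (Y w' z' t) (1%N, 0%N) v.
Let ver (w' z' : R) t := last_passage (Y w' z' t) (0%N, 1%N) v.

Let iY w' z' : (0 < w')%R -> (z' < 1)%R ->
  independent_with_laws P (boundary_law w' z') (Y w' z').
Proof. by move=> w0' z1'; exact: independent_rescale. Qed.

Let mY w' z' q : measurable_fun setT (fun t => Y w' z' t q : R).
Proof.
have mXq : measurable_fun setT (fun t => X t q : R) by exact: iX.1.
exact: measurable_funM.
Qed.

Let mhor w' z' : measurable_fun setT (hor w' z').
Proof. exact: measurable_last_passage. Qed.

Let mver w' z' : measurable_fun setT (ver w' z').
Proof. exact: measurable_last_passage. Qed.

Let lpp_hor_ver w' z' t :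
  lpp (Y w' z' t) v.1 v.2 = Num.max (hor w' z' t) (ver w' z' t).
Proof. exact: lppE_max. Qed.

(** No path from (1, 0) meets the vertical boundary. This is what allows the
    splittings (1 + 3) k and (1 + 7) k to be used for one and the same variable. *)
Lemma hor_vertical_parameter w' z' z'' t : hor w' z' t = hor w' z'' t.
Proof.
by apply/eqP; rewrite eq_le; apply/andP; split; apply: le_last_passage => //;
  case=> -[|i] [|j].
Qed.

Let parameters c : (0 <= c <= 7)%R ->
  [/\ (0 < r + c * k)%R, (r + c * k < 1)%R, (0 < r - c * k)%R & (r - c * k < 1)%R].
Proof.
have [r0 r1 _ _ _] := @gamma_zeta R v v1 v2.
by move=> c7; exact: small_multiple_unit.
Qed.

Let mgf_bounds a b : (0 <= a <= 7)%R -> (0 <= b <= 7)%R ->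
  (expR ((a + b) * k * G + y * ((a ^+ 3 + b ^+ 3) * (3 / 10))) <=
    lpp_mgf_value (r + a * k) (r - b * k) v <=
   expR ((a + b) * k * G + y * ((a ^+ 3 + b ^+ 3) * (11 / 30))))%R.
Proof.
move=> a7 b7.
have /andP[a0 ar] := small_multiple_le k0 kr a7.
have /andP[_ ar'] := small_multiple_le k0 kr' a7.
have /andP[b0 br] := small_multiple_le k0 kr b7.
have /andP[_ br'] := small_multiple_le k0 kr' b7.
have E c : ((a + b) * k * G + y * ((a ^+ 3 + b ^+ 3) * c) =
    G * (a * k + b * k) + (r * (1 - r))^-1 * G * ((a * k) ^+ 3 + (b * k) ^+ 3) * c)%R.
  by rewrite /y; ring.
by rewrite !E; exact: lpp_mgf_value_bounds.
Qed.

Let mgf_le (u : nat * nat) a b : (0 <= a <= 7)%R -> (0 <= b <= 7)%R ->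
  u = (1%N, 0%N) \/ u = (0%N, 1%N) ->
  \int[P]_t (expR ((a + b) * k * last_passage (Y (r + a * k) (r - b * k) t) u v))%:E <=
  (expR ((a + b) * k * G + y * ((a ^+ 3 + b ^+ 3) * (11 / 30))))%:E.
Proof.
move=> a7 b7 uE; have [wa0 wa1 _ _] := parameters a7.
have [_ _ zb0 zb1] := parameters b7.
have -> : ((a + b) * k = (r + a * k) - (r - b * k))%R by ring.
apply: (le_trans (integral_expR_last_passage_le _ _ _ _ _ _ _ uE (iY wa0 zb1))) => //.
  case/andP: a7 => a0 _; case/andP: b7 => b0 _.
  by rewrite lerD2l (@le_trans _ _ 0%R)// ?oppr_le0 mulr_ge0// ltW.
rewrite lee_fin; have /andP[_ /le_trans] := mgf_bounds a7 b7; apply.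
by rewrite ler_expR le_eqVlt; apply/orP; left; apply/eqP; ring.
Qed.

(** The vertical boundary of parameter zeta - 3 k has smaller weights than that of
    parameter zeta - 2 k, and for the latter the exponent 4 k is that of the splitting
    (2 + 2) k, whose cubic term is at most 16 (11 / 30) y. The bound is expressed
    with the lower bound 28 (3 / 10) y = (84 / 10) y for the splitting (1 + 3) k; the
    difference (76 / 30) y pays for the factor 1 / 2 since y >= 1. *)
Lemma integral_expR_ver_le :
  \int[P]_t (expR (4 * k * ver (r + k) (r - 3 * k) t))%:E <=
  (expR (4 * k * G + y * (84 / 10)) / 2)%:E.
Proof.
have le27 : (0 <= (2 : R) <= 7)%R by apply/andP; split; lra.
have le37 : (0 <= (3 : R) <= 7)%R by apply/andP; split; lra.
have [A [mA A0] XA] := weights_ge0 v iX.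
apply: (@le_trans _ _
    (\int[P]_t (expR (4 * k * ver (r + 2 * k) (r - 2 * k) t))%:E)).
  apply: ae_ge0_le_integral => //; [exact: measurable_expR_scaled..|].
  exists (~` A); split=> [|//|t /= nt At]; first exact: measurableC.
  apply: nt => _; rewrite lee_fin ler_expR ler_pM2l ?mulr_gt0//.
  apply: le_last_passage => // -[[|i] [|j]] //=; rewrite ?andbF// => q12.
  have X0 := XA t At (0%N, j.+1) isT q12; rewrite /Y /rescale ler_wpM2r//.
  apply: ler_wpM2l; first by rewrite subr_ge0 ltW.
  have [_ _ _ z3] := parameters le37; have [_ _ _ z2] := parameters le27.
  rewrite lef_pV2 ?posrE ?subr_gt0// lerD2l lerN2 lerD2l lerN2 ler_pM2r//; lra.
have {1 2}-> : (4 = 2 + 2 :> R)%R by ring.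
apply: (le_trans (mgf_le le27 le27 (or_intror erefl))).
rewrite lee_fin (_ : (2 + 2) * k * G = 4 * k * G)%R; last by ring.
have -> : (expR (4 * k * G + y * (84 / 10)) = expR (4 * k * G +
    y * ((2 ^+ 3 + 2 ^+ 3) * (11 / 30))) * expR (y * (76 / 30)))%R.
  by rewrite -expRD; congr expR; field.
rewrite -[leRHS]mulrA ler_peMr ?expR_ge0//.
by have := expR_ge1Dx (y * (76 / 30)); have := y1; lra.
Qed.

(** exp(4 k L) is at most the sum of the exponentials of hor and ver, and ver
    accounts for at most half of the expectation. *)
Lemma integral_expR_hor_ge :
  (expR (4 * k * G + y * (84 / 10)) / 2)%:E <=
  \int[P]_t (expR (4 * k * hor (r + k) (r - 3 * k) t))%:E.
Proof.
have le17 : (0 <= (1 : R) <= 7)%R by apply/andP; split; lra.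
have le37 : (0 <= (3 : R) <= 7)%R by apply/andP; split; lra.
have [wk0 wk1 _ _] := parameters le17; have [_ _ zk0 zk1] := parameters le37.
rewrite mul1r in wk0 wk1; set a := expR _.
have lower : a%:E <= \int[P]_t (expR (4 * k * hor (r + k) (r - 3 * k) t))%:E +
    \int[P]_t (expR (4 * k * ver (r + k) (r - 3 * k) t))%:E.
  rewrite -ge0_integralD//; [|exact: measurable_expR_scaled..].
  apply: (@le_trans _ _
      (\int[P]_t (expR (4 * k * lpp (Y (r + k) (r - 3 * k) t) v.1 v.2))%:E)).
    have -> : (4 * k = (r + k) - (r - 3 * k))%R by ring.
    rewrite lpp_mgf//; last exact: iY.
    rewrite -/(lpp_mgf_value _ _ v) lee_fin.
    have /andP[+ _] := mgf_bounds le17 le37; rewrite mul1r; apply: le_trans.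
    by rewrite /a ler_expR le_eqVlt; apply/orP; left; apply/eqP; field.
  apply: ge0_le_integral => //.
  - apply: measurable_expR_scaled; under eq_fun do rewrite lpp_hor_ver.
    exact: measurable_maxr.
  - by apply: emeasurable_funD; exact: measurable_expR_scaled.
  - move=> t _; rewrite lpp_hor_ver -EFinD lee_fin.
    by have [_|_] := leP (hor _ _ t); rewrite ?lerDl ?lerDr expR_ge0.
have -> : (a / 2)%:E = a%:E - (a / 2)%:E by rewrite -EFinB; congr EFin; field.
rewrite leeBlDr//; apply: (le_trans lower); rewrite leeD2l//.
exact: integral_expR_ver_le.
Qed.

(** The exponent 8 k is split as (1 + 7) k, and 344 = 1 + 7^3. *)
Lemma integral_expR_hor_sqr_le :
  \int[P]_t (expR (4 * k * hor (r + k) (r - 3 * k) t) ^+ 2)%:E <=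
  (expR (8 * k * G + y * (344 * (11 / 30))))%:E.
Proof.
have le17 : (0 <= (1 : R) <= 7)%R by apply/andP; split; lra.
have le77 : (0 <= (7 : R) <= 7)%R by apply/andP; split; lra.
have sqrE (x : R) : (expR (4 * k * x) ^+ 2 = expR (8 * k * x))%R.
  by rewrite -expRM_natl; congr expR; ring.
under eq_integral do rewrite sqrE (hor_vertical_parameter _ _ (r - 7 * k)).
have := mgf_le le17 le77 (or_introl erefl); rewrite mul1r.
have -> : ((1 + 7) * k = 8 * k)%R by ring.
by have -> : (1 ^+ 3 + 7 ^+ 3 = 344 :> R)%R by ring.
Qed.

(** The level comes from a / 4 >= exp(4 k G + y), where a = exp(4 k G + (84 / 10) y),
    since y / (4 k) is G k^2 / (4 r (1 - r)). The constant 130 exceeds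
    344 (11 / 30) - 2 (84 / 10) by enough to absorb the factor 1 / 16. *)
Lemma right_tail_hor_at_parameter :
  (expR (- (130 * y)))%:E <=
  P [set t | (G + (r * (1 - r))^-1 * G * k ^+ 2 / 4 <=
              hor (r + k) (r - 3 * k) t)%R].
Proof.
have [r0 r1 G0 _ _] := @gamma_zeta R v v1 v2.
have r1' : (0 < 1 - r)%R by rewrite subr_gt0.
have th0 : (0 < 4 * k)%R by rewrite mulr_gt0.
set a := expR (4 * k * G + y * (84 / 10)).
set b := expR (8 * k * G + y * (344 * (11 / 30))).
have a20 : (0 < a / 2)%R by rewrite divr_gt0// expR_gt0.
have b0 : (0 < b)%R by exact: expR_gt0.
have mexp : measurable_fun setT (fun t => expR (4 * k * hor (r + k) (r - 3 * k) t)).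
  by apply/measurable_EFinP; exact: measurable_expR_scaled.
have := paley_zygmund mexp (fun t => expR_ge0 _) a20 b0
  integral_expR_hor_ge integral_expR_hor_sqr_le.
set S0 := [set t | _] => PZ.
apply: (@le_trans _ _ (P S0)); last first.
  apply: le_measure; rewrite ?inE; [exact: measurable_superlevel..|].
  move=> t S0t; have : (expR (4 * k * G + y) <=
      expR (4 * k * hor (r + k) (r - 3 * k) t))%R.
    apply: le_trans S0t; rewrite /a.
    have -> : (expR (4 * k * G + y * (84 / 10)) =
        expR (4 * k * G + y) * expR (y * (74 / 10)))%R.
      by rewrite -expRD; congr expR; field.
    rewrite -[leRHS]mulrA -[leRHS]mulrA ler_peMr ?expR_ge0//.
    by have := expR_ge1Dx (y * (74 / 10)); have := y1; lra.
  rewrite ler_expR => h; rewrite /= -(ler_pM2l th0); apply: le_trans h.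
  rewrite le_eqVlt; apply/orP; left; apply/eqP; rewrite /y.
  by field; rewrite !gt_eqF.
apply: le_trans PZ; rewrite lee_fin ler_pdivlMr ?mulr_gt0//.
have -> : ((a / 2) ^+ 2 = expR (- (130 * y)) * b *
    (expR (y * (130 + 168 / 10 - 344 * (11 / 30))) / 4))%R.
  rewrite expr_div_n /a /b -expRM_natl mulrA -!expRD -natrX.
  by congr (expR _ / _)%R; field.
rewrite mulrCA -[leLHS]mulr1 [leLHS]mulrC; set e := expR (- (130 * y)).
have e4 : (4 <= expR (y * (130 + 168 / 10 - 344 * (11 / 30))) / 4)%R.
  by have := expR_ge1Dx (y * (130 + 168 / 10 - 344 * (11 / 30))); have := y1; lra.
rewrite mul1r mulrC ler_wpM2l// mulr_ge0 ?expR_ge0//.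
Qed.

End near_characteristic.

(** For w <= r + k, rescaling the bottom weights to rate r + k makes them smaller. *)
Lemma right_tail_hor X (w z k : R) (v : nat * nat) :
  let r := zeta (@vec R v) in let G := gamma (@vec R v) in
  let y := ((r * (1 - r))^-1 * G * k ^+ 3)%R in
  (0 < w)%R -> (z < 1)%R -> independent_with_laws P (boundary_law w z) X ->
  (0 < v.1)%N -> (0 < v.2)%N ->
  (0 < k)%R -> (k <= r / 280)%R -> (k <= (1 - r) / 280)%R -> (1 <= y)%R ->
  (w <= r + k)%R ->
  (expR (- (130 * y)))%:E <=
  P [set t | (G + (r * (1 - r))^-1 * G * k ^+ 2 / 4 <=
              last_passage (X t) (1%N, 0%N) v)%R].
Proof.
move=> r G y w0 z1 iX v1 v2 k0 kr kr' y1 wk.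
have [r0 r1 _ _ _] := @gamma_zeta R v v1 v2.
have rk0 : (0 < r + k)%R by exact: addr_gt0.
apply: (le_trans (right_tail_hor_at_parameter w0 z1 iX v1 v2 k0 kr kr' y1)).
have [A [mA A0] XA] := weights_ge0 v iX.
have mX q : measurable_fun setT (fun t => X t q : R) by exact: iX.1.
apply: (le_measure_mod_null _ _ mA A0).
- apply: measurable_superlevel; apply: measurable_last_passage => // q.
  exact: measurable_funM.
- by apply: measurable_superlevel; exact: measurable_last_passage.
move=> t At /= /le_trans; apply.
apply: le_last_passage => // -[[|i] [|j]] //= q12; last by rewrite /rescale mul1r.
have /andP[q1 q2] : (i < v.1)%N && (0 <= v.2)%N by move: q12.
have X0 := XA t At (i.+1, 0%N) q1 q2; rewrite /rescale.
by rewrite ler_piMl// ler_pdivrMr// mul1r.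
Qed.

End right_tail.

(** * The right tail for large deviations *)

Section moments.
Local Open Scope ereal_scope.
Context d (Omega : measurableType d) (R : realType) (P : probability Omega R).

(** Memorylessness applied to the indicator of the half-line. *)
Lemma exponential_law_tail (r M : R) : (0 < r)%R -> (0 <= M)%R ->
  exponential_law r `[M, +oo[%classic = (expR (- (r * M)))%:E.
Proof.
move=> r0 M0; have mI (c : R) : measurable (`[c, +oo[%classic : set (measurableTypeR R)).
  exact: measurable_itv.
pose g (x : measurableTypeR R) : \bar R :=
  (\1_(`[0%R, +oo[%classic : set (measurableTypeR R)) x)%:E.
have g1 : \int[exponential_law r]_x g x = 1.
  rewrite /g integral_indic//.
  by rewrite setIT; exact: exponential_law_ge0.
rewrite -[RHS]mule1 -g1 -(exponential_law_memoryless (g := g) r0 M0).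
- rewrite -[X in exponential_law r X]setIT -integral_indic//.
  by apply: eq_integral => x _; rewrite /g !indicE !mem_setE !in_itv/= !andbT subr_ge0.
- by apply/measurable_EFinP; exact: measurable_indic.
- by move=> x; rewrite lee_fin.
- move=> x x0; rewrite /g indicE memNset//= in_itv/= andbT.
  by apply/negP; rewrite -ltNge.
Qed.

(** The path that steps up from (1, 0) to (1, 1) and then stays in the bulk has
    v.1 + v.2 - 1 bulk weights, each at least M with probability exp(- M). *)
Lemma far_tail_hor X (w z M : R) (v : nat * nat) :
  independent_with_laws P (boundary_law w z) X ->
  (0 < v.1)%N -> (0 < v.2)%N -> (0 <= M)%R ->
  (expR (- (M * (v.1 + v.2).-1%:R)))%:E <=
  P [set t | (M * (v.1 + v.2).-1%:R <= last_passage (X t) (1%N, 0%N) v)%R].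
Proof.
move=> iX v1 v2 M0; have [mX iX'] := iX.
have [s us] := @up_right_paths_exist (1%N, 1%N) v v1 v2.
have ups : up_right_paths (1%N, 0%N) v ((1%N, 0%N) :: s).
  case: us => t [-> pt lt]; exists ((1%N, 1%N) :: t).
  by split=> //=; rewrite pt.
have sizes : size s = (v.1 + v.2).-1.
  have := up_right_paths_size us; rewrite /= addn1 => /eqP.
  by rewrite -[(1 + 1 + size s)%N]/((size s).+2) eqSS => /eqP ->.
have uniqs := up_right_paths_uniq ups.
pose B (q : nat * nat) : set (measurableTypeR R) :=
  if q.2 == 0%N then `[0%R, +oo[%classic else `[M, +oo[%classic.
have mB q : measurable (B q) by rewrite /B; case: ifP => _; exact: measurable_itv.
have bulk q : q \in s -> exists i j, q = (i.+1, j.+1).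
  move=> qs; have /and4P[] := up_right_paths_within us qs.
  by case: q {qs} => -[|i] [|j] //= _ _ _ _; exists i, j.
have PE : P (cylinder X ((1%N, 0%N) :: s) B) = (expR (- (M * (v.1 + v.2).-1%:R)))%:E.
  rewrite iX'// big_cons {1}/B /= exponential_law_ge0 mul1e.
  transitivity (\prod_(q <- s) (expR (- M))%:E).
    apply: eq_big_seq => q /bulk[i [j ->]]; rewrite /B /=.
    by rewrite exponential_law_tail// mul1r.
  rewrite prodEFin big_const_seq count_predT sizes iter_mulr_1 -expRM_natl.
  by congr (expR _)%:E; ring.
rewrite -PE; apply: le_measure; rewrite ?inE.
- exact: measurable_cylinder.
- apply: measurable_superlevel.
  by apply: measurable_last_passage => // q; exact: mX.
- move=> t Ct /=.
  have [_ smax] := last_passage_max (X t) (@up_right_paths_exist (1%N, 0%N) v v1 (leq0n _)).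
  apply: le_trans (smax _ ups); rewrite big_cons.
  have X0 : (0 <= X t (1%N, 0%N))%R.
    by have := Ct _ (mem_head _ _); rewrite /B /= in_itv/= andbT.
  rewrite -[leLHS]add0r lerD// -sizes.
  apply: (@le_trans _ _ (\sum_(q <- s) M)%R).
    by rewrite big_const_seq count_predT iter_addr_0 mulr_natr.
  rewrite big_seq [leRHS]big_seq; apply: ler_sum => q qs.
  have := Ct q; rewrite inE qs orbT => /(_ isT).
  by have [i [j ->]] := bulk _ qs; rewrite /B /= in_itv/= andbT.
Qed.

(** Markov's inequality for the power p of the deviation. *)
Lemma moment_ge_of_tail (H : Omega -> R) (g t p C : R) :
  measurable_fun setT H -> (0 <= t)%R -> (0 <= p)%R ->
  (expR (- (C * p)))%:E <= P [set u | (g + t <= H u)%R] ->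
  (expR (- C) `^ p * t `^ p)%:E <= 'E_P[fun u => (`|H u - g| `^ p)%R].
Proof.
move=> mH t0 p0 tail; set S := [set u | _] in tail.
have mS : measurable S by exact: measurable_superlevel.
rewrite unlock -expRM mulNr mulrC EFinM.
apply: (@le_trans _ _ ((t `^ p)%:E * P S)).
  by rewrite lee_wpmul2l// lee_fin powR_ge0.
rewrite -[S]setIT -integral_indic// -ge0_integralZl_EFin ?powR_ge0//; last first.
  by apply/measurable_EFinP; exact: measurable_indic.
have mHg : measurable_fun setT (fun u => `|H u - g|)%R.
  by apply: measurableT_comp => //; exact: measurable_funB.
apply: ge0_le_integral => //.
- by move=> u _; rewrite mule_ge0 ?lee_fin ?powR_ge0.
- by apply: measurable_funeM; apply/measurable_EFinP; exact: measurable_indic.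
- apply/measurable_EFinP; exact: (measurableT_comp (measurable_powR p) mHg).
- move=> u _; rewrite -EFinM lee_fin indicE.
  case: (boolP (u \in S)) => [/set_mem Su|_]; last by rewrite mulr0 powR_ge0.
  rewrite mulr1; apply: ge0_ler_powR => //; rewrite ?nnegrE//.
  by apply: le_trans (ler_norm _); rewrite lerBrDl.
Qed.

End moments.

(** * The moment bound for the horizontal boundary *)

Section shape_bounds.
Context {R : realType}.
Implicit Types (v : nat * nat).

Lemma gamma_norm1 v :
  @norm1 R (vec v) <= gamma (vec v) /\ gamma (vec v) <= 2 * @norm1 R (vec v).
Proof.
rewrite /norm1 /gamma /= !ger0_norm//.
have m0 : 0 <= (v.1%:R : R) by []; have n0 : 0 <= (v.2%:R : R) by [].
have a0 := sqrtr_ge0 (v.1%:R : R); have b0 := sqrtr_ge0 (v.2%:R : R).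
have mE := esym (sqr_sqrtr m0); have nE := esym (sqr_sqrtr n0).
move: a0 b0 mE nE; set a := Num.sqrt (v.1%:R : R); set b := Num.sqrt (v.2%:R : R).
move=> a0 b0 -> ->; have ab := mulr_ge0 a0 b0; have sq := sqr_ge0 (a - b); split; nra.
Qed.

Lemma zeta_bounds (delta : R) v : 0 < delta -> cone delta (vec v) ->
  let rho := Num.sqrt delta / (1 + Num.sqrt delta) in
  rho <= zeta (vec v) /\ zeta (vec v) <= 1 - rho.
Proof.
move=> d0 [m0 n0 mn nm] rho; rewrite /= in m0 n0 mn nm.
have D0 : 0 < Num.sqrt delta by rewrite sqrtr_gt0.
have a0 : 0 < Num.sqrt (v.1%:R : R) by rewrite sqrtr_gt0.
have b0 : 0 < Num.sqrt (v.2%:R : R) by rewrite sqrtr_gt0.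
have h1 : Num.sqrt delta * Num.sqrt v.2%:R <= Num.sqrt v.1%:R.
  by rewrite -(sqrtrM _ (ltW d0)) ler_wsqrtr.
have h2 : Num.sqrt delta * Num.sqrt v.1%:R <= Num.sqrt v.2%:R.
  by rewrite -(sqrtrM _ (ltW d0)) ler_wsqrtr.
rewrite /rho /zeta /=; move: D0 a0 b0 h1 h2.
set D := Num.sqrt delta; set a := Num.sqrt v.1%:R; set b := Num.sqrt v.2%:R.
move=> D0 a0 b0 h1 h2.
have ab : 0 < a + b by rewrite addr_gt0.
have D1 : 0 < 1 + D by rewrite addr_gt0.
have -> : 1 - D / (1 + D) = 1 / (1 + D) by field; rewrite gt_eqF.
by split; rewrite ler_pdivrMr// mulrAC ler_pdivlMr//; nra.
Qed.

End shape_bounds.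

Section horizontal_moments.
Context {R : realType}.

(** The change of variable that turns the target into a power of the deviation. *)
Lemma powR_scale (p N : R) : 0 < p -> 0 < N ->
  let s := p `^ (1 / 3) * N `^ (- (1 / 3)) in
  [/\ 0 < s, s ^+ 3 * N = p &
      p `^ (2 * p / 3) * N `^ (p / 3) = (s ^+ 2 * N) `^ p].
Proof.
move=> p0 N0 s; have s0 : 0 < s by rewrite mulr_gt0// powR_gt0.
have N1 : N `^ 1 = N by rewrite powRr1// ltW.
have p1 : p `^ 1 = p by rewrite powRr1// ltW.
split=> //.
- rewrite /s exprMn -!powR_mulrn ?powR_ge0// -!powRrM.
  have -> : 1 / 3 * 3%:R = 1 :> R by field.
  have -> : - (1 / 3) * 3%:R = - 1 :> R by field.
  by rewrite p1 powRN N1 divfK// gt_eqF.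
- rewrite powRM ?exprn_ge0 ?(ltW s0) ?(ltW N0)//.
  rewrite -powR_mulrn ?(ltW s0)// -powRrM /s powRM ?powR_ge0// -!powRrM.
  rewrite -[RHS]mulrA -powRD ?(gt_eqF N0) ?implybT//.
  by congr (_ `^ _ * _ `^ _); field.
Qed.

(** Here q >= 4 since r (1 - r) <= 1 / 4, and q <= rho^(-2); with N <= G <= 2 N and
    s^3 N = p, the quantity q G k^3 is between 4 A^3 p and 2 A^3 p / rho^2. *)
Lemma moderate_regime_estimates (A rho r G N s p : R) :
  1 <= A -> 0 < rho -> rho <= r -> r <= 1 - rho -> 0 < N -> N <= G ->
  G <= 2 * N -> 0 < s -> s ^+ 3 * N = p -> 1 <= p ->
  let q := (r * (1 - r))^-1 in let k := A * s in
  [/\ 1 <= q * G * k ^+ 3,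
      130 * (q * G * k ^+ 3) <= 260 * A ^+ 3 / rho ^+ 2 * p &
      s ^+ 2 * N <= q * G * k ^+ 2 / 4].
Proof.
move=> A1 rho0 rrho rrho' N0 GN G2N s0 s3 p1 q k.
have A0 : 0 < A by exact: lt_le_trans A1.
have r0 : 0 < r by lra.
have r1 : 0 < 1 - r by lra.
have k0 : 0 < k by rewrite mulr_gt0.
have rr0 : 0 < r * (1 - r) by exact: mulr_gt0.
have q4 : 4 <= q.
  have h2 : r * (1 - r) <= 4^-1 by have := sqr_ge0 (r - 1 / 2); nra.
  have h3 : 0 < (4^-1 : R) by rewrite invr_gt0.
  by rewrite -[4]invrK lef_pV2 ?posrE.
have qrho : q <= (rho ^+ 2)^-1.
  have h2 : rho ^+ 2 <= r * (1 - r) by rewrite expr2; apply: ler_pM; lra.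
  have h3 : 0 < rho ^+ 2 by rewrite exprn_gt0.
  by rewrite lef_pV2 ?posrE.
have k3 : k ^+ 3 * N = A ^+ 3 * p by rewrite /k exprMn -mulrA s3.
have k30 : 0 < k ^+ 3 by rewrite exprn_gt0.
have Ap1 : 1 <= A ^+ 3 * p by rewrite mulr_ege1// exprn_ege1.
have q0 : 0 <= q by lra.
have G0 : 0 <= G by lra.
have qGN : 4 * N <= q * G by exact: (ler_pM (ler0n _ 4) (ltW N0) q4 GN).
split.
- apply: (@le_trans _ _ (4 * N * k ^+ 3)); last by rewrite ler_wpM2r// ltW.
  by rewrite -mulrA (mulrC N) k3; lra.
- have -> : 260 * A ^+ 3 / rho ^+ 2 * p = 130 * ((rho ^+ 2)^-1 * (2 * N) * k ^+ 3).
    by rewrite -[in RHS]mulrA -[2 * N * _]mulrA (mulrC N) k3; field; rewrite gt_eqF.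
  rewrite ler_wpM2l// ler_wpM2r// ?(ltW k30)//.
  exact: (ler_pM q0 G0 qrho G2N).
- have -> : q * G * k ^+ 2 / 4 = q * G * (A ^+ 2 * (s ^+ 2 / 4)).
    by rewrite /k exprMn; ring.
  apply: (@le_trans _ _ (4 * N * (A ^+ 2 * (s ^+ 2 / 4)))); last first.
    by rewrite ler_wpM2r// mulr_ge0 ?divr_ge0 ?sqr_ge0.
  have -> : 4 * N * (A ^+ 2 * (s ^+ 2 / 4)) = s ^+ 2 * N * A ^+ 2 by field.
  by rewrite ler_peMr ?exprn_ege1// mulr_ge0 ?sqr_ge0// ltW.
Qed.

(** Here s^2 <= 1 + s^3 <= 1 + T, so the level is at most (3 + T) N, and
    N <= 2 (N - 1) explains the factor 2 in M. *)
Lemma large_regime_estimates (T eps G N s p : R) :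
  0 < T -> 0 < eps -> 2 <= N -> G <= 2 * N -> 0 < s -> s ^+ 3 * N = p ->
  p <= T * N -> eps <= s ^+ 3 ->
  let M := 2 * (3 + T) in
  M * (N - 1) <= M / eps * p /\ G + s ^+ 2 * N <= M * (N - 1).
Proof.
move=> T0 eps0 N2 G2N s0 s3 pT es M; have N0 : 0 < N by lra.
have M0 : 0 <= M by rewrite /M; lra.
have sT : s ^+ 3 <= T by rewrite -(ler_pM2r N0) s3.
have s2 : s ^+ 2 <= 1 + T.
  apply: (@le_trans _ _ (1 + s ^+ 3)); last by rewrite lerD2l.
  have [s1|s1] := leP s 1.
    by rewrite -[leLHS]addr0 lerD ?exprn_ile1 ?exprn_ge0// ltW.
  rewrite -[leLHS]add0r lerD// [leRHS]exprS ler_peMl ?sqr_ge0//.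
  exact: ltW.
split.
  rewrite -mulrA ler_wpM2l// -s3 mulrA.
  apply: (@le_trans _ _ (1 * N)); first by lra.
  by rewrite ler_pM2r// ler_pdivlMl// mulr1.
apply: (@le_trans _ _ (2 * N + (1 + T) * N)).
  by rewrite lerD// ler_pM2r.
by rewrite /M; nra.
Qed.

Section tails.
Context d (Omega : measurableType d) (P : probability Omega R)
  (X : Omega -> nat * nat -> R) (w z : R) (v : nat * nat).
Hypotheses (w0 : 0 < w) (z1 : z < 1)
  (iX : independent_with_laws P (boundary_law w z) X)
  (v1 : (0 < v.1)%N) (v2 : (0 < v.2)%N).
Local Notation N := (norm1 (@vec R v)).
Local Notation G := (gamma (@vec R v)).
Local Notation L := (fun t => last_passage (X t) (1%N, 0%N) v).

Let mL : measurable_fun setT L.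
Proof. by apply: measurable_last_passage => // q; exact: iX.1. Qed.

Let NE : N = (v.1 + v.2)%:R.
Proof. by rewrite /norm1 /= !ger0_norm// natrD. Qed.

Lemma hor_tail_moderate (A rho s p : R) :
  1 <= A -> 0 < rho -> rho <= zeta (@vec R v) -> zeta (@vec R v) <= 1 - rho ->
  0 < s -> s ^+ 3 * N = p -> 1 <= p -> A * s <= rho / 280 ->
  w <= zeta (@vec R v) + A * s ->
  ((expR (- (260 * A ^+ 3 / rho ^+ 2 * p)))%:E <=
   P [set t | G + s ^+ 2 * N <= L t]%R)%E.
Proof.
move=> A1 rho0 rrho rrho' s0 s3 p1 small wk.
have N0 : 0 < N by rewrite NE ltr0n addn_gt0 v1.
have [GN G2N] := @gamma_norm1 R v.
have [y1 yC t0] := moderate_regime_estimates A1 rho0 rrho rrho' N0 GN G2N s0 s3 p1.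
have k0 : 0 < A * s by rewrite mulr_gt0// (lt_le_trans _ A1).
have kr : A * s <= zeta (@vec R v) / 280 by apply: (le_trans small); rewrite ler_pM2r.
have kr' : A * s <= (1 - zeta (@vec R v)) / 280.
  by apply: (le_trans small); rewrite ler_pM2r// lerBrDr addrC -lerBrDr.
have tail := right_tail_hor w0 z1 iX v1 v2 k0 kr kr' y1 wk.
apply: (@le_trans _ _ (expR (- (130 * _)))%:E).
  by rewrite lee_fin ler_expR lerN2; exact: yC.
apply: (le_trans tail); apply: le_measure; rewrite ?inE;
  [exact: measurable_superlevel..|].
by move=> t /=; apply: le_trans; rewrite lerD2l.
Qed.

Lemma hor_tail_large (T eps s p : R) :
  0 < T -> 0 < eps -> 0 < s -> s ^+ 3 * N = p -> p <= T * N -> eps <= s ^+ 3 ->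
  ((expR (- (2 * (3 + T) / eps * p)))%:E <=
   P [set t | G + s ^+ 2 * N <= L t]%R)%E.
Proof.
move=> T0 eps0 s0 s3 pT es.
have N2 : 2 <= N.
  rewrite NE ler_nat; case: (v) v1 v2 => -[|a] [|b] //= _ _.
  by rewrite addSn addnS.
have NE' : (v.1 + v.2).-1%:R = N - 1 :> R.
  by rewrite NE -[in RHS](@prednK (v.1 + v.2)) ?addn_gt0 ?v1// -natr1 addrK.
have [_ G2N] := @gamma_norm1 R v.
have [Mp GM] := large_regime_estimates T0 eps0 N2 G2N s0 s3 pT es.
have M0 : 0 <= 2 * (3 + T) by lra.
have := far_tail_hor iX v1 v2 M0; rewrite NE' => tail.
apply: (@le_trans _ _ (expR (- (2 * (3 + T) * (N - 1))))%:E).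
  by rewrite lee_fin ler_expR lerN2.
apply: (le_trans tail); apply: le_measure; rewrite ?inE;
  [exact: measurable_superlevel..|].
by move=> t /=; exact: le_trans.
Qed.

End tails.

(** The two regimes are separated by k = rho / 280 for k = (K + 1) s and rho the lower
    bound of zeta and 1 - zeta on the cone, that is by s^3 = eps; C1 and C2 are the
    constants of the corresponding tail bounds, and exp(- (C1 + C2)) serves for
    both. *)
Lemma hor_moment_lower_bound (delta K T : R) :
  0 < delta -> 0 <= K -> 0 < T -> exists2 c0 : R, 0 < c0 &
  forall (v : nat * nat) (p w z : R), cone delta (vec v) ->
    (0 < v.1)%N -> (0 < v.2)%N -> 1 <= p -> p <= T * norm1 (vec v) ->
    0 < w -> z < 1 ->
    w <= zeta (vec v) +
       K * Num.min (p `^ (1 / 3) * norm1 (vec v) `^ (- (1 / 3))) 1 ->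
  forall d (Omega : measurableType d) (P : probability Omega R)
    (X : Omega -> nat * nat -> R), independent_with_laws P (boundary_law w z) X ->
  ((c0 `^ p * p `^ (2 * p / 3) * norm1 (vec v) `^ (p / 3))%R%:E <=
   'E_P[fun t => (`|last_passage (X t) (1%N, 0%N) v - gamma (vec v)| `^ p)%R])%E.
Proof.
move=> d0 K0 T0; have A1 : 1 <= K + 1 by rewrite lerDr.
have D0 : 0 < Num.sqrt delta by rewrite sqrtr_gt0.
have : 0 < Num.sqrt delta / (1 + Num.sqrt delta) by rewrite divr_gt0// addr_gt0.
have := fun v => @zeta_bounds R delta v d0.
move: (Num.sqrt delta / (1 + Num.sqrt delta)) => rho zb rho0.
move: (K + 1) A1 (lerDl K 1) => A A1 KA; have A0 : 0 < A by exact: lt_le_trans A1.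
have KleA : K <= A by rewrite KA.
have A280 : 0 < 280 * A by rewrite mulr_gt0.
have : 0 < (rho / (280 * A)) ^+ 3 by rewrite exprn_gt0// divr_gt0.
move: {-1}((rho / (280 * A)) ^+ 3) (erefl ((rho / (280 * A)) ^+ 3)) => eps epsE eps0.
have : 0 <= 260 * A ^+ 3 / rho ^+ 2 by rewrite divr_ge0 ?mulr_ge0 ?exprn_ge0// ltW.
have : 0 <= 2 * (3 + T) / eps.
  by rewrite divr_ge0// ?(ltW eps0)// mulr_ge0// addr_ge0// ltW.
move: {-1}(260 * A ^+ 3 / rho ^+ 2) (erefl (260 * A ^+ 3 / rho ^+ 2)) => C1 C1E.
move: {-1}(2 * (3 + T) / eps) (erefl (2 * (3 + T) / eps)) => C2 C2E C20 C10.
exists (expR (- (C1 + C2))); first exact: expR_gt0.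
move=> v p w z vcone v1 v2 p1 pT w0 z1 wK d Omega P X iX.
have [rrho rrho'] := zb v vcone.
have p0 : 0 < p by exact: lt_le_trans p1.
have N0 : 0 < norm1 (@vec R v).
  by case: vcone => m0 n0 _ _; rewrite addr_gt0// normr_gt0 gt_eqF.
have [s0 s3 sE] := powR_scale p0 N0.
rewrite -mulrA sE {sE}; move: (p `^ (1 / 3) * _) wK s0 s3 => s wK s0 s3.
have mL : measurable_fun setT (fun t => last_passage (X t) (1%N, 0%N) v).
  by apply: measurable_last_passage => // q; exact: iX.1.
have t0 : 0 <= s ^+ 2 * norm1 (@vec R v) by rewrite mulr_ge0 ?sqr_ge0// ltW.
apply: (moment_ge_of_tail mL t0 (ltW p0)).
have [small|large] := leP (A * s) (rho / 280).
  apply: (@le_trans _ _ (expR (- (C1 * p)))%:E).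
    by rewrite lee_fin ler_expR lerN2 ler_pM2r// lerDl.
  rewrite -C1E; apply: (hor_tail_moderate w0 z1 iX v1 v2 A1 rho0) => //.
  apply: (le_trans wK); rewrite lerD2l.
  apply: (@le_trans _ _ (K * s)); first by rewrite ler_wpM2l// ge_min lexx.
  by rewrite ler_wpM2r// ltW.
apply: (@le_trans _ _ (expR (- (C2 * p)))%:E).
  by rewrite lee_fin ler_expR lerN2 ler_pM2r// lerDr.
rewrite -C2E; apply: (hor_tail_large iX v1 v2 T0 eps0 s0 s3 pT).
have en : rho / (280 * A) \is Num.nneg by rewrite nnegrE ltW// divr_gt0.
have sn : s \is Num.nneg by rewrite nnegrE ltW.
rewrite -epsE; apply: (lerXn2r 3 en sn).
rewrite ler_pdivrMr// ltW// (_ : s * (280 * A) = A * s * 280); last by ring.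
by rewrite -ltr_pdivrMr.
Qed.

End horizontal_moments.

(** * Reflection in the diagonal *)

Section transposition.
Context {R : realType}.

Definition transpose (q : nat * nat) : nat * nat := (q.2, q.1).

Lemma transposeK : involutive transpose.
Proof. by case. Qed.

Lemma up_right_paths_transpose u v s : up_right_paths u v s ->
  up_right_paths (transpose u) (transpose v) (map transpose s).
Proof.
move=> [t [-> pt <-]]; exists (map transpose t); split=> //=; last by rewrite last_map.
apply: (homo_path _ pt) => -[i j] q /orP[] /eqP -> /=.
  exact: up_right_step_ver.
exact: up_right_step_hor.
Qed.

Lemma last_passage_transpose (x : nat * nat -> R) u v :
  last_passage (fun q => x (transpose q)) u v =
  last_passage x (transpose u) (transpose v).
Proof.
congr sup; apply/seteqP; split => r /= [s us <-].
  exists (map transpose s); first exact: up_right_paths_transpose.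
  by rewrite big_map.
exists (map transpose s); last by rewrite big_map; under eq_bigr do rewrite transposeK.
by rewrite -[u]transposeK -[v]transposeK; exact: up_right_paths_transpose.
Qed.

Lemma norm1_transpose v : @norm1 R (vec (transpose v)) = norm1 (vec v).
Proof. by rewrite /norm1 /= addrC. Qed.

Lemma gamma_transpose v : @gamma R (vec (transpose v)) = gamma (vec v).
Proof. by rewrite /gamma /= addrC. Qed.

Lemma zeta_transpose v : (0 < v.1)%N ->
  @zeta R (vec (transpose v)) = 1 - zeta (vec v).
Proof.
move=> v1; rewrite /zeta /=.
have a0 : 0 < Num.sqrt (v.1%:R : R) by rewrite sqrtr_gt0 ltr0n.
have b0 := sqrtr_ge0 (v.2%:R : R).
move: a0 b0; set a := Num.sqrt (v.1%:R : R); set b := Num.sqrt (v.2%:R : R).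
move=> a0 b0; have ab : a + b != 0 by rewrite gt_eqF// ltr_wpDr.
rewrite [b + a]addrC; field.
by rewrite ?ab.
Qed.

Lemma cone_transpose (delta : R) v :
  cone delta (vec v) -> cone delta (vec (transpose v)).
Proof. by case. Qed.

End transposition.

Section boundary_weights.
Local Open Scope ereal_scope.
Context d (Omega : measurableType d) (R : realType) (P : probability Omega R).

(** The constant weight at the origin has the law [exponential_law 0]. *)
Lemma independent_boundary_weights (w z : R) (omega : nat * nat -> {RV P >-> R}) :
  (0 < w)%R -> (z < 1)%R -> boundary_weights w z omega ->
  independent_with_laws P (boundary_law w z) (fun t q => omega q t).
Proof.
move=> w0 z1 [bulk hor ver origin indep]; split=> [q|s B us mB].
  exact: (measurable_funP (D := setT) (omega q)).
have -> : cylinder (fun t q => omega q t) s B =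
    \big[setI/setT]_(q <- s) (omega q @^-1` B q).
  elim: s {us} => [|q s IH]; first by rewrite cylinder_nil big_nil.
  by rewrite cylinder_cons IH big_cons.
transitivity (\prod_(q <- s) P (omega q @^-1` B q)).
  exact: (indep s B us mB).
apply: eq_bigr => -[i j] _.
case: i j => [|i] [|j]; rewrite /boundary_law.
- rewrite /exponential_law; case: pselect => [h|_].
    by exfalso; move: (h); rewrite ltxx.
  rewrite /= diracE; have [h|h] := pselect (B (0%N, 0%N) 0%R).
    rewrite mem_set// (_ : _ @^-1` _ = setT) ?probability_setT//.
    by apply/seteqP; split=> t //= _; rewrite origin.
  rewrite memNset// (_ : _ @^-1` _ = set0) ?measure0//.
  by apply/seteqP; split=> t //=; rewrite origin.
- by rewrite exponential_lawE ?subr_gt0//; exact: (ver j _ (mB _)).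
- by rewrite exponential_lawE//; exact: (hor i _ (mB _)).
- by rewrite exponential_lawE//; exact: (bulk i j _ (mB _)).
Qed.

Lemma independent_transpose (w z : R) (X : Omega -> nat * nat -> R) :
  independent_with_laws P (boundary_law w z) X ->
  independent_with_laws P (boundary_law (1 - z) (1 - w)) (fun t q => X t (transpose q)).
Proof.
move=> [mX iX]; split=> [q|s B us mB]; first exact: mX.
have -> : cylinder (fun t q => X t (transpose q)) s B =
    cylinder X (map transpose s) (B \o transpose).
  apply/seteqP; split=> t h q.
    by move=> /mapP[q' q's ->]; rewrite /= transposeK; exact: h.
  move=> qs; have := h (transpose q); rewrite /= transposeK; apply.
  by rewrite map_f.
rewrite iX ?(map_inj_uniq (can_inj transposeK))//; last by move=> q; exact: mB.
rewrite big_map; apply: eq_bigr => -[i j] _ /=.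
by case: i j => [|i] [|j]; rewrite /boundary_law //= opprB addrC subrK.
Qed.

End boundary_weights.

Theorem theorem2p9 (R : realType) (delta K T : R)
    (hdelta : 0 < delta) (hK : 0 <= K) (hT : 0 < T) :
  exists (c0 : R) (N0 : nat), [/\ 0 < c0, (0 < N0)%N &
    forall (v : nat * nat) (p w z : R),
      cone delta (vec v) -> (N0 <= v.1)%N -> (N0 <= v.2)%N ->
      1 <= p -> p <= T * norm1 (vec v) ->
      0 < w -> z < 1 ->
      forall (d : measure_display) (Omega : measurableType d)
        (P : probability Omega R) (omega : nat * nat -> {RV P >-> R}),
        boundary_weights w z omega ->
        (w <= zeta (vec v) +
              K * Num.min (p `^ (1 / 3) * norm1 (vec v) `^ (- (1 / 3))) 1 ->
         ((c0 `^ p * p `^ (2 * p / 3) * norm1 (vec v) `^ (p / 3))%R%:E <=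
            'E_P[fun t => (`|Ghor omega v t - gamma (vec v)| `^ p)%R])%E)
        /\
        (zeta (vec v) -
           K * Num.min (p `^ (1 / 3) * norm1 (vec v) `^ (- (1 / 3))) 1 <= z ->
         ((c0 `^ p * p `^ (2 * p / 3) * norm1 (vec v) `^ (p / 3))%R%:E <=
            'E_P[fun t => (`|Gver omega v t - gamma (vec v)| `^ p)%R])%E)].
Proof.
have [c0 c00 bound] := hor_moment_lower_bound hdelta hK hT.
exists c0, 1%N; split=> // v p w z vcone v1 v2 p1 pT w0 z1 d Omega P omega bw.
have iX := independent_boundary_weights w0 z1 bw; split=> [wK|zK].
  exact: bound iX.
have := bound (transpose v) p (1 - z) (1 - w) (cone_transpose vcone) v2 v1 p1.
rewrite norm1_transpose gamma_transpose zeta_transpose//.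
have z0' : 0 < 1 - z by rewrite subr_gt0.
have w1' : 1 - w < 1 by rewrite gtrBl.
have wK : 1 - z <= 1 - zeta (vec v) +
    K * Num.min (p `^ (1 / 3) * norm1 (vec v) `^ (- (1 / 3))) 1 by lra.
move=> /(_ pT z0' w1' wK _ _ _ _ (independent_transpose iX)) transposed_bound.
have -> : Gver omega v = fun t =>
    last_passage (fun q => omega (transpose q) t) (1%N, 0%N) (transpose v).
  apply/funext => t.
  by rewrite (last_passage_transpose (fun q => omega q t)) transposeK.
exact: transposed_bound.
Qed.
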